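(* Let $p$ be a prime, $m\in\mathbb N$, and let $\mu_\alpha=\bigotimes_{k=1}^m\mu_\alpha^k$, $\mu_\alpha^k=\bigotimes_{n=k+1}^\infty\mu_{\alpha_{kn}}$, be a product measure on $X^m$, where $\mu_{\alpha_{kn}}$ are probability measures on $\mathbb F_p$ with $\mu_{\alpha_{kn}}(r)=\alpha_{kn}(r)>0$ for all $r\in\mathbb F_p$. If $\mu_\alpha^k\sim\mu_{inv}^k$ for some $1\le k\le m$, then the Laplace operator $$\Delta_k=\operatorname{s-lim}_{r\to\infty}\ \prod_{n=k+1}^{r}p^{-1}C(T_{kn}(k))$$ is well defined and commutes with the quasiregular representation $T^{R,\mu_\alpha,m}$ of $B_0^{\mathbb N}(\mathbb F_p)$. In particular, if $\mu_\alpha\sim\mu_{inv}=\bigotimes_{k=1}^m\mu^k_{inv}$, then the Laplace operator $\Delta^{(m)}:=\Delta_1\Delta_2\cdots\Delta_m$ is well defined and commutes with the representation.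
   Context: $B_0^{\mathbb N}(\mathbb F_p)$ is the group of infinite upper triangular matrices $I+\sum_{1\le k<n}x_{kn}E_{kn}$ over $\mathbb F_p$ with finitely many nonzero $x_{kn}$ (here $E_{kn}$ are the matrix units). $X^m$ is the set of arrays $x=(x_{kn})_{1\le k\le m,\,k<n}$, $x_{kn}\in\mathbb F_p$, viewed as the first $m$ rows of an infinite upper triangular matrix with units on the diagonal; $R_t(x)=xt^{-1}$ for $t\in B_0^{\mathbb N}(\mathbb F_p)$, and $(T^{R,\mu_\alpha,m}_tf)(x)=\big(d\mu_\alpha(R_t^{-1}(x))/d\mu_\alpha(x)\big)^{1/2}f(R_t^{-1}(x))$ on $L^2(X^m,\mu_\alpha)=\bigotimes_{k=1}^mL^2(X^{(k)},\mu_\alpha^k)$, where $X^{(k)}$ is the space of $k$-th rows $(x_{kn})_{n>k}$. The operator $T_{kn}(k)$ acts on the factor $L^2(X^{(k)},\mu^k_\alpha)$ (and as the identity on the other factors) as the unitary operator induced by the shift of the single coordinate $x_{kn}$: $$(T_{kn}(k)f)(x)=\sqrt{\frac{\alpha_{kn}(x_{kn}-1)}{\alpha_{kn}(x_{kn})}}\ f(\dots,x_{kn}-1,\dots).$$ $C(T)=\sum_{r\in\mathbb F_p}T^r$. $\mu_{inv}^k=\bigotimes_{n=k+1}^\infty\mu_{inv}^{kn}$ with $\mu^{kn}_{inv}(r)=1/p$ for $r\in\mathbb F_p$; $\sim$ is equivalence of measures; s-lim denotes the limit in the strong operator topology. *)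

(* Defs.v *)
From HB Require Import structures.
From mathcomp Require Import all_boot all_order all_algebra.
From mathcomp Require Import all_classical all_reals all_analysis.
From mathcomp Require Import complex.

Set Implicit Arguments.
Unset Strict Implicit.
Unset Printing Implicit Defensive.
Import Order.TTheory GRing.Theory Num.Theory.
Import numFieldNormedType.Exports.

Local Open Scope classical_set_scope.
Local Open Scope complex_scope.
Local Open Scope charge_scope.
Local Open Scope ring_scope.

(* Rows and columns of all matrices are numbered from 0 instead of from 1. *)

(** * The group of finitary infinite upper unitriangular matrices over F_p *)

Record B0N (p : nat) : Type := MkB0N {
  B0N_entry :> nat -> nat -> 'F_p;
  B0N_diag : forall i, B0N_entry i i = 1;
  B0N_low : forall i j, (j < i)%N -> B0N_entry i j = 0;
  (* Entries above the diagonal satisfy i < j, so bounding the column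
     says that only finitely many of them are nonzero. *)
  B0N_fin : exists N, forall i j, (i < j)%N -> (N <= j)%N -> B0N_entry i j = 0
}.

Section B0N_group.
Variable p : nat.
Implicit Types s t u : B0N p.

HB.instance Definition _ := gen_eqMixin (B0N p).
HB.instance Definition _ := gen_choiceMixin (B0N p).

Lemma B0N_ext s t : (forall i j, s i j = t i j) -> s = t.
Proof.
case: s t => [s s1 s2 s3] [t t1 t2 t3] /= st.
have e : s = t by apply/funext => i; apply/funext => j.
by subst t; congr MkB0N; exact: Prop_irrelevance.
Qed.

Lemma B0N_col t : exists N, forall i j, (N <= j)%N -> t i j = (i == j)%:R.
Proof.
have [N tN] := B0N_fin t; exists N => i j Nj.
case: (ltngtP i j) => [ij|ij|->]; last exact: B0N_diag.
  exact: tN.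
exact: B0N_low.
Qed.

Definition B0N_one_entry (i j : nat) : 'F_p := (i == j)%:R.

Definition B0N_mul_entry s t (i j : nat) : 'F_p :=
  \sum_(l < j.+1) s i l * t l j.

(* Row i of the inverse matrix v of t, computed from v * t = 1, that is
   v i j = [i = j] - \sum_(l < j) v i l * t l j. *)
Definition B0N_inv_row t (i n : nat) : seq 'F_p :=
  iter n (fun v => rcons v ((i == size v)%:R
                            - \sum_(l < size v) v`_l * t l (size v))) [::].

Definition B0N_inv_entry t (i j : nat) : 'F_p := (B0N_inv_row t i j.+1)`_j.

Lemma size_B0N_inv_row t i n : size (B0N_inv_row t i n) = n.
Proof. by elim: n => //= n IH; rewrite size_rcons IH. Qed.

Lemma nth_B0N_inv_row t i n j : (j < n)%N ->
  (B0N_inv_row t i n)`_j = B0N_inv_entry t i j.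
Proof.
elim: n => // n IH; rewrite ltnS leq_eqVlt => /orP[/eqP->//|jn].
by rewrite [B0N_inv_row _ _ _]/= nth_rcons size_B0N_inv_row jn IH.
Qed.

Lemma B0N_inv_entryE t i j : B0N_inv_entry t i j =
  (i == j)%:R - \sum_(l < j) B0N_inv_entry t i l * t l j.
Proof.
rewrite {1}/B0N_inv_entry [B0N_inv_row _ _ _]/= nth_rcons size_B0N_inv_row ltnn.
rewrite eqxx; congr (_ - _); apply: eq_bigr => l _.
by rewrite nth_B0N_inv_row.
Qed.

Lemma B0N_one_subproof :
  [/\ forall i, B0N_one_entry i i = 1,
      forall i j, (j < i)%N -> B0N_one_entry i j = 0 &
      exists N, forall i j, (i < j)%N -> (N <= j)%N -> B0N_one_entry i j = 0].
Proof.
split=> [i|i j ji|]; rewrite /B0N_one_entry ?eqxx ?gtn_eqF//.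
by exists 0%N => i j ij _; rewrite ltn_eqF.
Qed.

Definition B0N_one : B0N p := let: And3 h1 h2 h3 := B0N_one_subproof in
  MkB0N h1 h2 h3.

Lemma B0N_oneE i j : B0N_one i j = (i == j)%:R.
Proof. by rewrite /B0N_one; case: B0N_one_subproof. Qed.

Lemma B0N_mul_subproof s t :
  [/\ forall i, B0N_mul_entry s t i i = 1,
      forall i j, (j < i)%N -> B0N_mul_entry s t i j = 0 &
      exists N, forall i j, (i < j)%N -> (N <= j)%N ->
        B0N_mul_entry s t i j = 0].
Proof.
split=> [i|i j ji|].
- rewrite /B0N_mul_entry big_ord_recr /= !B0N_diag mulr1 big1 ?add0r// => l _.
  by rewrite B0N_low ?mul0r.
- rewrite /B0N_mul_entry big1 // => l _.
  by rewrite (B0N_low s) ?mul0r// (leq_trans (ltn_ord l)).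
have [N1 sN] := B0N_col s; have [N2 tN] := B0N_col t.
exists (maxn N1 N2) => i j ij; rewrite geq_max => /andP[N1j N2j].
rewrite /B0N_mul_entry big_ord_recr /= sN// ltn_eqF// mul0r addr0 big1// => l _.
by rewrite tN// ltn_eqF// mulr0.
Qed.

Definition B0N_mul s t : B0N p := let: And3 h1 h2 h3 := B0N_mul_subproof s t in
  MkB0N h1 h2 h3.

Lemma B0N_mulE s t i j : B0N_mul s t i j = \sum_(l < j.+1) s i l * t l j.
Proof. by rewrite /B0N_mul; case: B0N_mul_subproof. Qed.

Lemma B0N_inv_low t i j : (j < i)%N -> B0N_inv_entry t i j = 0.
Proof.
elim/ltn_ind: j => j IH ji; rewrite B0N_inv_entryE gtn_eqF// big1 ?subr0//.
by move=> l _; rewrite IH ?mul0r// (ltn_trans (ltn_ord l)).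
Qed.

Lemma B0N_inv_subproof t :
  [/\ forall i, B0N_inv_entry t i i = 1,
      forall i j, (j < i)%N -> B0N_inv_entry t i j = 0 &
      exists N, forall i j, (i < j)%N -> (N <= j)%N -> B0N_inv_entry t i j = 0].
Proof.
split=> [i|i j|]; [|exact: B0N_inv_low|].
  rewrite B0N_inv_entryE eqxx big1 ?subr0// => l _.
  by rewrite B0N_inv_low ?mul0r.
have [N tN] := B0N_col t; exists N => i j ij Nj.
rewrite B0N_inv_entryE ltn_eqF// big1 ?subr0// => l _.
by rewrite tN// ltn_eqF// mulr0.
Qed.

Definition B0N_inv t : B0N p := let: And3 h1 h2 h3 := B0N_inv_subproof t in
  MkB0N h1 h2 h3.

Lemma B0N_invE t i j : B0N_inv t i j = B0N_inv_entry t i j.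
Proof. by rewrite /B0N_inv; case: B0N_inv_subproof. Qed.

(* The range of summation in a product of an arbitrary row by a column of a
   triangular matrix can be enlarged at will. *)
Lemma B0N_sum_widen (f : nat -> 'F_p) t j n : (j < n)%N ->
  \sum_(l < j.+1) f l * t l j = \sum_(l < n) f l * t l j.
Proof.
move=> jn; rewrite (big_ord_widen_cond n predT (fun l => f l * t l j))//.
rewrite big_mkcond; apply: eq_bigr => l _ /=.
by case: ifPn => //; rewrite -leqNgt => jl; rewrite B0N_low ?mulr0.
Qed.

Lemma B0N_mulKA (f : nat -> 'F_p) s t j :
  \sum_(l < j.+1) (\sum_(q < l.+1) f q * s q l) * t l j =
  \sum_(q < j.+1) f q * B0N_mul s t q j.
Proof.
under eq_bigr => l _ do
  rewrite (B0N_sum_widen f s (n := j.+1) (ltn_ord l)) mulr_suml.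
rewrite exchange_big /=; apply: eq_bigr => q _.
rewrite B0N_mulE mulr_sumr; apply: eq_bigr => l _; exact/esym/mulrA.
Qed.

Lemma B0N_mulA : associative B0N_mul.
Proof.
move=> s t u; apply: B0N_ext => i j; rewrite [RHS]B0N_mulE [LHS]B0N_mulE.
rewrite -(B0N_mulKA (s i)); apply: eq_bigr => l _; by rewrite B0N_mulE.
Qed.

Lemma B0N_sum_one (f : nat -> 'F_p) j :
  \sum_(l < j.+1) f l * B0N_one l j = f j.
Proof.
rewrite big_ord_recr /= B0N_oneE eqxx mulr1 big1 ?add0r// => l _.
by rewrite B0N_oneE ltn_eqF// mulr0.
Qed.

Lemma B0N_mulr1 : right_id B0N_one B0N_mul.
Proof. by move=> t; apply: B0N_ext => i j; rewrite B0N_mulE B0N_sum_one. Qed.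

Lemma B0N_mul1r : left_id B0N_one B0N_mul.
Proof.
move=> t; apply: B0N_ext => i j; rewrite B0N_mulE.
have [ij|ji] := leqP i j; last first.
  rewrite (B0N_low t)// big1// => l _.
  by rewrite B0N_oneE gtn_eqF ?mul0r// (leq_trans (ltn_ord l)).
rewrite (bigD1 (Ordinal (ij : (i < j.+1)%N)))//= B0N_oneE eqxx mul1r.
rewrite big1 ?addr0// => l /eqP li; rewrite B0N_oneE.
by case: eqP => [il|_]; [case: li; exact: val_inj|rewrite mul0r].
Qed.

Lemma B0N_mulVr : left_inverse B0N_one B0N_inv B0N_mul.
Proof.
move=> t; apply: B0N_ext => i j; rewrite B0N_mulE B0N_oneE big_ord_recr /=.
rewrite B0N_diag mulr1 !B0N_invE [B0N_inv_entry _ _ j]B0N_inv_entryE.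
under eq_bigr do rewrite B0N_invE.
by rewrite addrCA subrr addr0.
Qed.

Lemma B0N_mulrV : right_inverse B0N_one B0N_inv B0N_mul.
Proof.
move=> t; have := B0N_mulVr (B0N_inv t); set v := B0N_inv (B0N_inv t) => e.
suff tv : t = v by rewrite {1}tv.
by rewrite -[LHS]B0N_mul1r -e -B0N_mulA B0N_mulVr B0N_mulr1.
Qed.

HB.instance Definition _ := isGroup.Build (B0N p)
  B0N_mulA B0N_mul1r B0N_mulr1 B0N_mulVr B0N_mulrV.

End B0N_group.

(** * Configuration spaces and product measures *)

Definition conf_pre (p : nat) (I : Type) : Type := I -> 'F_p.

HB.instance Definition _ p I := gen_eqMixin (conf_pre p I).
HB.instance Definition _ p I := gen_choiceMixin (conf_pre p I).
HB.instance Definition _ p I := isPointed.Build (conf_pre p I) (fun=> 0).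

Definition coord_sets (p : nat) (I : Type) : set (set (conf_pre p I)) :=
  [set [set x | x i = r] | i in [set: I] & r in [set: 'F_p]].

(* F_p^I with the product sigma-algebra, F_p being discrete. *)
Notation conf p I := (g_sigma_algebraType (@coord_sets p I)).

(* mu is the product over i of the measures {r} |-> a i r, characterized by its
   values on the cylinder sets. *)
Definition is_product_measure (R : realType) (p : nat) (I : eqType)
    (a : I -> 'F_p -> R) (mu : probability (conf p I) R) : Prop :=
  forall (s : seq I) (x : conf p I), uniq s ->
    mu [set y | {in s, forall i, y i = x i}] = (\prod_(i <- s) a i (x i))%:E.

Definition mequiv d (T : measurableType d) (R : realType)
    (mu nu : {measure set T -> \bar R}) : Prop := mu `<< nu /\ nu `<< mu.

(* Index sets of the k-th row, and of the first m rows *)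
Definition row_idx (k : nat) : Type := {n : nat | (k < n)%N}.
Definition tri_idx (m : nat) : Type := {kn : 'I_m * nat | (kn.1 < kn.2)%N}.

Section quasiregular.
Context (R : realType) (p m : nat).
Local Notation X := (conf p (tri_idx m)).

(* x as the first m rows of an upper unitriangular matrix *)
Definition entry (x : X) (k : 'I_m) (n : nat) : 'F_p :=
  if insub (k, n) is Some i then x (i : tri_idx m) else (n == k :> nat)%:R.

(* R_t x = x t^-1, restricted to the entries above the diagonal *)
Definition Rt (t : B0N p) (x : X) : X := fun i : tri_idx m =>
  \sum_(l < (val i).2.+1) entry x (val i).1 l * (t^-1)%g l (val i).2.

Lemma entry_Rt t x k n :
  entry (Rt t x) k n = \sum_(l < n.+1) entry x k l * (t^-1)%g l n.
Proof.
rewrite {1}/entry; case: insubP => [i _ vi|/= nkn]; first by rewrite /Rt vi.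
have e l : (l <= n)%N -> entry x k l = (l == k :> nat)%:R.
  rewrite /entry; case: insubP => //= i /= kl _ ln.
  by rewrite (leq_trans kl ln) in nkn.
under eq_bigr => l _ do rewrite (e _ (leq_ord l)).
rewrite big_ord_recr /= B0N_diag mulr1 big1 ?add0r// => l _.
by rewrite ltn_eqF ?mul0r// (leq_trans (ltn_ord l))// leqNgt.
Qed.

Lemma entry_tri (x : X) (i : tri_idx m) : entry x (val i).1 (val i).2 = x i.
Proof. by rewrite /entry -surjective_pairing valK. Qed.

Lemma RtM s t x : Rt (s * t)%g x = Rt s (Rt t x).
Proof.
apply/funext => i; rewrite /Rt; under [RHS]eq_bigr do rewrite entry_Rt.
rewrite (B0N_mulKA (entry x (val i).1)).
by apply: eq_bigr => l _; rewrite invgM.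
Qed.

Lemma Rt1 x : Rt 1%g x = x.
Proof.
apply/funext => i; rewrite /Rt invg1.
by rewrite -[RHS]entry_tri; exact: (B0N_sum_one (entry x (val i).1)).
Qed.

Lemma measurable_conf_fun d (T : measurableType d) (I : Type)
    (f : T -> conf p I) :
  (forall i r, measurable [set x | f x i = r]) -> measurable_fun setT f.
Proof.
move=> mf; apply: (@measurability _ _ T (conf p I) setT f (@coord_sets p I)) => //.
by move=> _ [_ [i _ [r _ <-]] <-]; rewrite setTI; exact: mf.
Qed.

Lemma measurable_entry k n (r : 'F_p) : measurable [set x | entry x k n = r].
Proof.
rewrite /entry; case: insubP => [i _ _|_].
  by apply: sub_sigma_algebra; exists i => //; exists r.
have [->|/eqP nr] := eqVneq (n == k :> nat)%:R r.
  by rewrite (_ : mkset _ = setT)//; apply/seteqP.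
by rewrite (_ : mkset _ = set0)//; apply/seteqP; split.
Qed.

Lemma measurable_lincomb d (T : measurableType d) n
    (f : 'I_n -> T -> 'F_p) (c : 'I_n -> 'F_p) (r : 'F_p) :
  (forall l r', measurable [set x | f l x = r']) ->
  measurable [set x | \sum_(l < n) f l x * c l = r].
Proof.
elim: n f c r => [|n IH] f c r mf.
  have [<-|/eqP nr] := eqVneq 0 r.
    by rewrite (_ : mkset _ = setT)//; apply/seteqP; split=> // x _ /=;
       rewrite big_ord0.
  by rewrite (_ : mkset _ = set0)//; apply/seteqP; split=> // x /=;
     rewrite big_ord0.
rewrite (_ : mkset _ = \bigcup_(s in [set: 'F_p])
  ([set x | f ord_max x = s] `&`
   [set x | \sum_(l < n) f (widen_ord (leqnSn n) l) x
      * c (widen_ord (leqnSn n) l) = r - s * c ord_max])).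
  by apply: fin_bigcup_measurable => // s _; apply: measurableI => //;
     apply: (IH (fun l => f (widen_ord _ l))).
apply/seteqP; split=> [x /= <-|x [s _ [/= <- e]]].
  by exists (f ord_max x) => //; split=> //=; rewrite big_ord_recr /= addrK.
by rewrite big_ord_recr /= e subrK.
Qed.

Lemma measurable_Rt t : measurable_fun [set: X] (Rt t).
Proof.
apply: measurable_conf_fun => i r; apply: measurable_lincomb => l r'.
exact: measurable_entry.
Qed.

HB.instance Definition _ t := isMeasurableFun.Build _ _ X X (Rt t)
  (measurable_Rt t).

(* The quasiregular representation: the measure A |-> mu (R_t^-1 A), written
   d mu (R_t^-1 x) in the density, is the image of mu under R_t. *)
Definition repT (mu : probability X R) (t : B0N p) (f : X -> R[i]) : X -> R[i] :=
  fun x => (Num.sqrt (fine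
    (('d (charge_of_finite_measure (distribution mu (Rt t))) '/d mu) x)))%:C
    * f (Rt t^-1%g x).

Definition shift (k : 'I_m) (n : nat) (x : X) : X := fun i : tri_idx m =>
  if val i == (k, n) then x i - 1 else x i.

Definition shiftT (alpha : 'I_m -> nat -> 'F_p -> R) (k : 'I_m) (n : nat)
    (f : X -> R[i]) : X -> R[i] :=
  fun x => (Num.sqrt (alpha k n (entry x k n - 1) / alpha k n (entry x k n)))%:C
           * f (shift k n x).

Definition avgC (T : (X -> R[i]) -> X -> R[i]) (f : X -> R[i]) : X -> R[i] :=
  fun x => \sum_(r : 'F_p) iter r T f x.

(* the product over k < n <= r of the operators p^-1 C(T_kn(k)) *)
Definition laplace_seq (alpha : 'I_m -> nat -> 'F_p -> R) (k : 'I_m) (r : nat) :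
    (X -> R[i]) -> X -> R[i] :=
  \big[comp/id]_(k.+1 <= n < r.+1)
    (fun f x => p%:R^-1 * avgC (shiftT alpha k n) f x).

End quasiregular.

(** * Operators on complex L^2 spaces *)

(* An operator on L^2(mu) is represented by a map on complex functions, which
   is only relevant on square-integrable ones and up to equality mu-a.e. *)
Section operators.
Context d (T : measurableType d) (R : realType).
Variable mu : {measure set T -> \bar R}.
Local Notation op := ((T -> R[i]) -> T -> R[i]).

Definition L2norm (f : T -> R[i]) : \bar R :=
  Lnorm mu 2%:E (fun x => (Normc.normc (f x))%:E).

Definition L2 (f : T -> R[i]) : Prop :=
  [/\ measurable_fun setT (fun x => complex.Re (f x)),
      measurable_fun setT (fun x => complex.Im (f x)) &
      (L2norm f < +oo)%E].

Definition bounded_operator (A : op) : Prop :=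
  [/\ forall f, L2 f -> L2 (A f),
      forall f g, L2 f -> L2 g -> f = g %[ae mu] -> A f = A g %[ae mu],
      forall (c : R[i]) f g, L2 f -> L2 g ->
        A (fun x => c * f x + g x) = (fun x => c * A f x + A g x) %[ae mu] &
      exists M : R, forall f, L2 f -> (L2norm (A f) <= M%:E * L2norm f)%E].

Definition is_slim (P : nat -> op) (A : op) : Prop :=
  bounded_operator A /\
  forall f, L2 f -> (fun r => L2norm (fun x => P r f x - A f x)) @ \oo --> 0%E.

Definition slim_exists (P : nat -> op) : Prop := exists A, is_slim P A.

(* Junk value id when the strong limit does not exist. *)
Definition slim (P : nat -> op) : op :=
  if pselect (slim_exists P) is left e then sval (cid e) else id.

End operators.

Section laplace.
Context (R : realType) (p m : nat).
Local Notation X := (conf p (tri_idx m)).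
Variables (alpha : 'I_m -> nat -> 'F_p -> R) (mu : probability X R).

Definition laplace (k : 'I_m) : (X -> R[i]) -> X -> R[i] :=
  slim mu (laplace_seq alpha k).

Definition laplace_prod : (X -> R[i]) -> X -> R[i] :=
  \big[comp/id]_(k < m) laplace k.

Definition commutes_with_rep (A : (X -> R[i]) -> X -> R[i]) : Prop :=
  forall (t : B0N p) f, L2 mu f ->
    A (repT mu t f) = repT mu t (A f) %[ae mu].

End laplace.

(* Main.v *)
From HB Require Import structures.
Require Import Defs.
From mathcomp Require Import all_boot all_order all_algebra.
From mathcomp Require Import all_classical all_reals all_analysis.
From mathcomp Require Import measurable_realfun complex ring lra.
Import Order.TTheory GRing.Theory Num.Theory.
Import numFieldNormedType.Exports.
Set Implicit Arguments.
Unset Strict Implicit.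
Unset Printing Implicit Defensive.
Local Open Scope classical_set_scope.
Local Open Scope complex_scope.
Local Open Scope charge_scope.
Local Open Scope ring_scope.

(* Conjugation by the square root of the product of the densities alpha_kn over
   finitely many coordinates turns T_kn(k) into the translation of x_kn and T_t
   into composition with the permutation x |-> xt of these coordinates.  Hence
   the product of the first r factors p^-1 C(T_kn(k)) averages over the group of
   translations of the coordinates (x_kn)_{k<n<=r} of the k-th row.  It is
   an orthogonal projection, decreasing in r, and therefore converges strongly by
   Pythagoras and the completeness of L^2.  Right multiplication by t is linear on
   the k-th row and touches only finitely many columns, so for large r it
   permutes the translations being averaged: the averages commute with T_t, and
   so does their limit. *)

(** * Completeness of real L^2 *)

(** The obstacle is null sets. Operators act on functions rather than on classes, and [repT]
    contains a Radon-Nikodym derivative that is determined only almost everywhere. The operators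
    [transport] carry an explicit radicand instead: over one fixed finite set of coordinates the
    quotients of weights telescope, so transports compose exactly, at every point. The algebra of
    the averages is therefore pointwise, and null sets matter only when [repT] is replaced by a
    transport and when the limit is taken. The set of coordinates in a transport is not canonical,
    but coordinates that are not moved cancel from the quotient, so any two transports can be
    brought to a common set before being composed. No inner product appears. Orthogonality enters
    through the variance identity for finitely many complex numbers, which is integrated to give
    Pythagoras for the squared norm [energy]; this form makes sense for infinite energies as
    well. *)

Section riesz_fischer.
Context d (T : measurableType d) (R : realType).
Variable mu : {measure set T -> \bar R}.
Variable u : nat -> T -> R.
Hypothesis mu_ : forall n, measurable_fun setT (u n).

Let dist2 (f g : T -> R) : \bar R := (\int[mu]_x ((f x - g x) ^+ 2)%:E)%E.

Let msqr (f g : T -> R) : measurable_fun setT f -> measurable_fun setT g ->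
  measurable_fun setT (fun x => ((f x - g x) ^+ 2)%:E).
Proof.
by move=> mf mg; apply/measurable_EFinP/measurable_funX; exact: measurable_funB.
Qed.

Lemma cvgn_EFin (a : nat -> R) (l : R) :
  a @ \oo --> l -> (fun k => (a k)%:E) @ \oo --> l%:E.
Proof. by move=> al; apply: cvg_EFin => //; exact: nearW. Qed.

(** Serves to derive measurability of a pointwise lower limit from that of an upper limit. *)
Lemma limn_einf_opp (a : nat -> \bar R) :
  limn_einf a = (- limn_esup (fun k => - a k))%E.
Proof.
rewrite -limn_einfN; congr limn_einf; apply/funext => k /=.
by rewrite oppeK.
Qed.

Lemma limn_einf_ge0 (a : nat -> R) : (forall k, 0 <= a k) ->
  (0 <= limn_einf (fun k => (a k)%:E))%E.
Proof.
move=> a0; rewrite limn_einf_lim; apply: lime_ge; first exact: is_cvg_einfs.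
apply: nearW => n; apply: le_ereal_inf_tmp => _ [k _ <-].
by rewrite lee_fin.
Qed.

(** Expanding 2^k (|e| - 2^-k)^2 >= 0 gives |e| <= 2^-k + 2^k e^2 for each increment e, so the
    increments are absolutely summable. The weights 2^k are what lets squares control absolute
    values. *)
Lemma summable_increments_cvg (a : nat -> R) :
  (\sum_(0 <= k <oo) (2 ^+ k * (a k.+1 - a k) ^+ 2)%:E < +oo)%E ->
  cvgn a.
Proof.
move=> s.
have cs : cvgn (series (fun k => 2 ^+ k * (a k.+1 - a k) ^+ 2)).
  apply: nondecreasing_is_cvgn.
    apply: (@nondecreasing_series _ _ predT) => k _ _.
    by rewrite mulr_ge0 ?sqr_ge0 ?exprn_ge0.
  exists (fine (\sum_(0 <= k <oo) (2 ^+ k * (a k.+1 - a k) ^+ 2)%:E)%E).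
  move=> _ [n _ <-]; rewrite -lee_fin fineK; last first.
    rewrite ge0_fin_numE//; apply: nneseries_ge0 => k _ _.
    by rewrite lee_fin mulr_ge0 ?sqr_ge0 ?exprn_ge0.
  rewrite /series/= -sumEFin; apply: nneseries_lim_ge => k _ _.
  by rewrite lee_fin mulr_ge0 ?sqr_ge0 ?exprn_ge0.
have cg : cvgn (series (fun k => 2^-1 ^+ k : R)).
  have := @is_cvg_geometric_series R 1 2^-1.
  rewrite (_ : geometric 1 2^-1 = fun k => 2^-1 ^+ k).
    by apply; rewrite ger0_norm// invf_lt1// ltr1n.
  by apply/funext => k; rewrite /geometric/= mul1r.
have cd : cvgn (series (fun k => a k.+1 - a k)).
  apply: normed_cvg.
  apply: (@series_le_cvg _ _ (fun k => 2^-1 ^+ k + 2 ^+ k * (a k.+1 - a k) ^+ 2)).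
  - by move=> k /=.
  - move=> k; apply: addr_ge0; first by apply: exprn_ge0; rewrite invr_ge0.
    by apply: mulr_ge0; [exact: exprn_ge0|exact: sqr_ge0].
  - move=> k /=; rewrite exprVn; set b := 2 ^+ k; set e := a k.+1 - a k.
    have b0 : 0 < b by rewrite exprn_gt0.
    have h : 0 <= b * (`|e| - b^-1) ^+ 2 by rewrite mulr_ge0 ?sqr_ge0// ltW.
    have bb : b * b^-1 = 1 by rewrite divff// gt_eqF.
    have : b * (`|e| - b^-1) ^+ 2 = b * e ^+ 2 - 2 * `|e| + b^-1.
      by rewrite -(real_normK (num_real e)); field; rewrite gt_eqF.
    have := normr_ge0 e; lra.
  - have -> : series (fun k => 2^-1 ^+ k + 2 ^+ k * (a k.+1 - a k) ^+ 2) =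
       (series (fun k => 2^-1 ^+ k : R)) \+ (series (fun k => 2 ^+ k * (a k.+1 - a k) ^+ 2)).
      by apply/funext => n; rewrite /series/= big_split.
    exact: is_cvgD.
have -> : a = (fun k => a 0%N + series (fun k => a k.+1 - a k) k).
  apply/funext => k; rewrite /series/= telescope_sumr//; ring.
by apply: is_cvgD => //; exact: is_cvg_cst.
Qed.

(** Riesz-Fischer. Along a subsequence with squared distances at most 4^-k, the series of increments
    weighted by 2^k has integral at most the sum of 2^k 4^-k = 2^-k. It is thus finite almost
    everywhere, and the subsequence converges there. *)
Lemma L2_complete :
  (forall e : R, 0 < e -> exists N, forall m n, (N <= m)%N -> (N <= n)%N ->
     (dist2 (u m) (u n) <= e%:E)%E) ->
  exists2 v : T -> R, measurable_fun setT v &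
  forall e : R, 0 < e -> exists N, forall n, (N <= n)%N ->
     (dist2 (u n) v <= e%:E)%E.
Proof.
move=> cau.
have /choice[N NP] : forall k, exists N, forall m n, (N <= m)%N -> (N <= n)%N ->
     (dist2 (u m) (u n) <= (4^-1 ^+ k)%:E)%E.
  by move=> k; apply: cau; rewrite exprn_gt0.
(* The sum makes [n_] nondecreasing and at least [N k]; the extra k makes it tend to infinity. *)
pose n_ k := (\sum_(i < k.+1) N i + k)%N.
have n_S k : (n_ k <= n_ k.+1)%N.
  by rewrite /n_ [in leqRHS]big_ord_recr/= leq_add// leq_addr.
have n_N k : (N k <= n_ k)%N.
  by rewrite /n_ big_ord_recr/= -addnA (leq_trans _ (leq_addl _ _))// leq_addr.
have n_k k : (k <= n_ k)%N by rewrite /n_ leq_addl.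
pose w k x := u (n_ k) x.
have mw k : measurable_fun setT (w k) by exact: mu_.
pose g x := (\sum_(0 <= k <oo) (2 ^+ k * (w k.+1 x - w k x) ^+ 2)%:E)%E.
have g_ge0 k x : (0 <= (2 ^+ k * (w k.+1 x - w k x) ^+ 2)%:E)%E.
  by rewrite lee_fin mulr_ge0 ?sqr_ge0 ?exprn_ge0.
have mgk k : measurable_fun setT (fun x => (2 ^+ k * (w k.+1 x - w k x) ^+ 2)%:E).
  apply/measurable_EFinP/measurable_funM => //.
  by apply: measurable_funX; exact: (measurable_funB (mw _) (mw _)).
have mg : measurable_fun setT g by exact: ge0_emeasurable_sum.
have ig : (\int[mu]_x g x < +oo)%E.
  rewrite /g integral_nneseries//.
  apply: (@le_lt_trans _ _ (\sum_(0 <= k <oo) (2^-1 ^+ k : R)%:E)%E); last first.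
    rewrite (_ : (fun n => _) = EFin \o series (fun k => 2^-1 ^+ k : R)).
      have h1 : `|2^-1 : R| < 1 by rewrite ger0_norm// invf_lt1// ltr1n.
      have := @cvg_geometric_series R 1 2^-1 h1.
      rewrite (_ : geometric 1 2^-1 = fun k => 2^-1 ^+ k); last first.
        by apply/funext => k; rewrite /geometric/= mul1r.
      by move=> /cvgn_EFin/cvg_lim -> //; rewrite ltry.
    by apply/funext => n; rewrite /series/= sumEFin.
  apply: lee_nneseries => [k _ _|k _]; first exact: integral_ge0.
  under eq_integral do rewrite EFinM.
  rewrite ge0_integralZl//; last 2 first.
    by apply: msqr; apply: mu_.
    by move=> x _; rewrite lee_fin sqr_ge0.
  have -> : (2^-1 ^+ k : R)%:E = ((2 ^+ k)%:E * (4^-1 ^+ k)%:E)%E.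
    rewrite -EFinM -exprMn; congr ((_ ^+ _)%:E); by lra.
  by apply: lee_wpmul2l => //; apply: NP; rewrite ?n_N// (leq_trans (n_N k)).
have aeg : {ae mu, forall x, (g x < +oo)%E}.
  have : mu.-integrable setT g.
    apply/integrableP; split=> //; under eq_integral => x _.
      rewrite gee0_abs; last by apply: nneseries_ge0 => k _ _; exact: g_ge0.
    over. by [].
  move/(integrable_ae measurableT); apply: filterS => x /(_ I).
  by rewrite ge0_fin_numE//; apply: nneseries_ge0 => k _ _; exact: g_ge0.
have aew : {ae mu, forall x, cvgn (w ^~ x)}.
  by apply: filterS aeg => x; exact: summable_increments_cvg.
(* An upper limit exists at every point, so [v] is measurable on the whole space, including where
   the subsequence diverges. *)
pose v x := fine (limn_esup (fun k => (w k x)%:E)).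
have mv : measurable_fun setT v.
  apply: measurableT_comp => //; apply: measurable_fun_limn_esup => k.
  exact/measurable_EFinP.
have aev : {ae mu, forall x, w ^~ x @ \oo --> v x}.
  apply: filterS aew => x cw; suff -> : v x = limn (w ^~ x) by [].
  have /cvgn_EFin h : w ^~ x @ \oo --> limn (w ^~ x) by [].
  rewrite /v is_cvg_limn_esupE//; last by apply/cvg_ex; eexists; exact: h.
  by rewrite (cvg_lim _ h).
exists v => // e e0; have [M MP] := cau e e0.
exists M => n Mn.
rewrite /dist2.
(* Almost everywhere the integrand is the lower limit of the squared distances to the subsequence,
   so Fatou carries the Cauchy estimate over to [v]. *)
rewrite (@ge0_ae_eq_integral _ _ _ mu setT _
   (fun x => limn_einf (fun k => ((u n x - w k x) ^+ 2)%:E)))//.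
- apply: le_trans (fatou _ _ _ _) _ => //.
  + by move=> k; exact: msqr (mu_ _) (mu_ _).
  + by move=> k x _; rewrite lee_fin sqr_ge0.
  rewrite limn_einf_lim; apply: lime_le; first exact: is_cvg_einfs.
  near=> k; rewrite /einfs/=.
  apply: ereal_inf_le.
  exists (dist2 (u n) (u (n_ k))).
    by exists k => //=.
  apply: MP => //; rewrite (leq_trans _ (n_k k))//.
  by near: k; exists M.
- exact: msqr (mu_ _) mv.
- under eq_fun do rewrite limn_einf_opp.
  apply: measurableT_comp => //; apply: measurable_fun_limn_esup => k.
  by apply: measurableT_comp => //; exact: msqr (mu_ _) (mu_ _).
- by move=> x _; rewrite lee_fin sqr_ge0.
- by move=> x _; apply: limn_einf_ge0 => k; exact: sqr_ge0.
- apply: filterS aev => x wv _.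
  have h : (fun k => ((u n x - w k x) ^+ 2)%:E) @ \oo --> ((u n x - v x) ^+ 2)%:E.
    apply: cvgn_EFin.
    apply: (@cvg_comp _ _ _ (fun k => u n x - w k x) (fun y : R => y ^+ 2)).
      by apply: cvgB wv; exact: cvg_cst.
    exact: exprn_continuous.
  rewrite is_cvg_limn_einfE; first by rewrite (cvg_lim _ h).
  by apply/cvg_ex; eexists; exact: h.
Unshelve. all: by end_near.
Qed.
End riesz_fischer.

(** * Complex square-integrable functions *)

Section squared_modulus.
Context (R : realType).
Implicit Types z w : R[i].

Definition nsq z : R := complex.Re z ^+ 2 + complex.Im z ^+ 2.

Lemma nsq_ge0 z : 0 <= nsq z.
Proof. by rewrite /nsq addr_ge0// sqr_ge0. Qed.

Lemma ReD z w : complex.Re (z + w) = complex.Re z + complex.Re w.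
Proof. by case: z w => [? ?] []. Qed.

Lemma ImD z w : complex.Im (z + w) = complex.Im z + complex.Im w.
Proof. by case: z w => [? ?] []. Qed.

Lemma ReN z : complex.Re (- z) = - complex.Re z.
Proof. by case: z. Qed.

Lemma ImN z : complex.Im (- z) = - complex.Im z.
Proof. by case: z. Qed.

Lemma ReM z w : complex.Re (z * w) =
  complex.Re z * complex.Re w - complex.Im z * complex.Im w.
Proof. by case: z w => [? ?] []. Qed.

Lemma ImM z w : complex.Im (z * w) =
  complex.Re z * complex.Im w + complex.Im z * complex.Re w.
Proof. by case: z w => [? ?] []. Qed.

Lemma Re_sum (I : Type) (s : seq I) (F : I -> R[i]) :
  complex.Re (\sum_(i <- s) F i) = \sum_(i <- s) complex.Re (F i).
Proof. by elim/big_rec2: _ => // i x y _ <-; rewrite ReD. Qed.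

Lemma Im_sum (I : Type) (s : seq I) (F : I -> R[i]) :
  complex.Im (\sum_(i <- s) F i) = \sum_(i <- s) complex.Im (F i).
Proof. by elim/big_rec2: _ => // i x y _ <-; rewrite ImD. Qed.

Lemma complex_eq z w :
  complex.Re z = complex.Re w -> complex.Im z = complex.Im w -> z = w.
Proof. by case: z w => [? ?] [? ?] /= -> ->. Qed.

Lemma nsqM z w : nsq (z * w) = nsq z * nsq w.
Proof. by rewrite /nsq ReM ImM; ring. Qed.

Lemma nsq_real (a : R) : nsq a%:C = a ^+ 2.
Proof. by rewrite /nsq/= expr0n/= addr0. Qed.

Lemma nsqN z : nsq (- z) = nsq z.
Proof. by rewrite /nsq ReN ImN !sqrrN. Qed.

Lemma nsqD_le z w : nsq (z + w) <= 2 * (nsq z + nsq w).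
Proof.
rewrite /nsq ReD ImD; set a := complex.Re z; set b := complex.Im z.
set c := complex.Re w; set e := complex.Im w.
have := sqr_ge0 (a - c); have := sqr_ge0 (b - e).
by rewrite !sqrrD !sqrrN; lra.
Qed.

Lemma nsq_eq0 z : nsq z = 0 -> z = 0.
Proof.
move/eqP; rewrite /nsq paddr_eq0 ?sqr_ge0// !sqrf_eq0 => /andP[/eqP a /eqP b].
exact: complex_eq.
Qed.

Lemma normc_nsq z : Normc.normc z ^+ 2 = nsq z.
Proof. by case: z => a b /=; rewrite sqr_sqrtr// addr_ge0// sqr_ge0. Qed.

(** The variance decomposition: deviations from the mean sum to zero, so the cross term vanishes. It
    is applied to real and imaginary parts separately and is the pointwise form of Pythagoras. *)
Lemma sum_nsqB_mean (I : finType) (z : I -> R[i]) (s := \sum_i z i) :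
  \sum_i nsq (z i - #|I|%:R^-1 * s) + #|I|%:R * nsq (#|I|%:R^-1 * s) =
  \sum_i nsq (z i).
Proof.
have nC (n : nat) : n%:R^-1 = (n%:R^-1 : R)%:C :> R[i].
  by rewrite fmorphV/= rmorph_nat.
have [I0|I0] := eqVneq #|I| 0%N.
  rewrite I0 mul0r addr0 !big_pred0// => i;
  by have := fintype0 i I0.
have n0 : #|I|%:R != 0 :> R by rewrite pnatr_eq0.
have var (a : I -> R) : \sum_i (a i - #|I|%:R^-1 * \sum_i a i) ^+ 2
    = \sum_i a i ^+ 2 - #|I|%:R * (#|I|%:R^-1 * \sum_i a i) ^+ 2.
  set m := _ * _.
  have -> : \sum_i (a i - m) ^+ 2 = \sum_i (a i ^+ 2 - 2 * m * a i + m ^+ 2).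
    by apply: eq_bigr => i _; ring.
  rewrite !big_split/= sumrN -mulr_sumr sumr_const -[m ^+ 2 *+ _]mulr_natl.
  have -> : \sum_i a i = #|I|%:R * m by rewrite /m mulVKf.
  by ring.
have mean : #|I|%:R^-1 * s = (#|I|%:R^-1 * \sum_i complex.Re (z i))
    +i* (#|I|%:R^-1 * \sum_i complex.Im (z i)).
  by apply: complex_eq; rewrite nC ?ReM ?ImM /= /s ?Re_sum ?Im_sum; ring.
rewrite mean.
under eq_bigr do rewrite /nsq ReD ImD ReN ImN /=.
rewrite big_split/= !var /nsq/= [RHS]big_split/=; ring.
Qed.

End squared_modulus.

Section energy.
Context d (T : measurableType d) (R : realType).
Variable mu : {measure set T -> \bar R}.
Implicit Types f g : T -> R[i].

(** The square of [L2norm]. Convergence and bounds are handled with squares, which add up in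
    Pythagoras and need no roots; [L2normE] and [L2norm_le] translate back. *)
Definition energy f : \bar R := (\int[mu]_x (nsq (f x))%:E)%E.

Definition cmeasurable f : Prop :=
  measurable_fun setT (fun x => complex.Re (f x)) /\
  measurable_fun setT (fun x => complex.Im (f x)).

Lemma cmeasurableD f g : cmeasurable f -> cmeasurable g ->
  cmeasurable (fun x => f x + g x).
Proof.
move=> [f1 f2] [g1 g2]; split.
  by under eq_fun do rewrite ReD; exact: measurable_funD.
by under eq_fun do rewrite ImD; exact: measurable_funD.
Qed.

Lemma cmeasurableM f g : cmeasurable f -> cmeasurable g ->
  cmeasurable (fun x => f x * g x).
Proof.
move=> [f1 f2] [g1 g2]; split.
  by under eq_fun do rewrite ReM; apply: measurable_funB; exact: measurable_funM.
by under eq_fun do rewrite ImM; apply: measurable_funD; exact: measurable_funM.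
Qed.

Lemma cmeasurable_cst (c : R[i]) : cmeasurable (fun=> c).
Proof. by split; exact: measurable_cst. Qed.

Lemma cmeasurable_real (a : T -> R) : measurable_fun setT a ->
  cmeasurable (fun x => (a x)%:C).
Proof. by move=> ma; split=> //=; exact: measurable_cst. Qed.

Lemma cmeasurableB f g : cmeasurable f -> cmeasurable g ->
  cmeasurable (fun x => f x - g x).
Proof.
move=> mf mg; under eq_fun do rewrite -mulN1r.
by apply: cmeasurableD => //; apply: cmeasurableM => //; exact: cmeasurable_cst.
Qed.

Lemma cmeasurable_sum (I : Type) (s : seq I) (F : I -> T -> R[i]) :
  (forall i, cmeasurable (F i)) -> cmeasurable (fun x => \sum_(i <- s) F i x).
Proof.
move=> mF; elim: s => [|i s IH].
  by under eq_fun do rewrite big_nil; exact: cmeasurable_cst.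
by under eq_fun do rewrite big_cons; exact: cmeasurableD.
Qed.

Lemma cmeasurable_comp (S : T -> T) f : measurable_fun setT S ->
  cmeasurable f -> cmeasurable (f \o S).
Proof.
move=> mS [f1 f2]; split.
  exact: (measurableT_comp (f := fun x => complex.Re (f x))).
exact: (measurableT_comp (f := fun x => complex.Im (f x))).
Qed.

Lemma measurable_nsq f : cmeasurable f ->
  measurable_fun setT (fun x => (nsq (f x))%:E).
Proof.
move=> [f1 f2]; apply/measurable_EFinP.
by apply: measurable_funD; apply: measurable_funX.
Qed.

Lemma energy_ge0 f : (0 <= energy f)%E.
Proof. by apply: integral_ge0 => x _; rewrite lee_fin nsq_ge0. Qed.

Lemma L2normE f : L2norm mu f = (energy f `^ 2^-1)%E.
Proof.
rewrite /L2norm unlock; congr (_ `^ _)%E; apply: eq_integral => x _.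
have nf : 0 <= Normc.normc (f x) by case: (f x) => a b /=; exact: sqrtr_ge0.
by rewrite gee0_abs// poweR_EFin powR_mulrn// normc_nsq.
Qed.

Lemma L2norm_sqr f : (L2norm mu f `^ 2)%E = energy f.
Proof. by rewrite L2normE -poweRrM mulVf// poweRe1// energy_ge0. Qed.

Lemma L2P f : L2 mu f <-> cmeasurable f /\ (energy f < +oo)%E.
Proof.
split=> [[f1 f2]|[[f1 f2] h]].
  by rewrite L2normE => /lty_poweRy h; split=> //; apply: h.
by split=> //; rewrite L2normE; exact: poweR_lty.
Qed.

Lemma L2norm_le f (e : R) : 0 <= e ->
  (L2norm mu f <= e%:E)%E = (energy f <= (e ^+ 2)%:E)%E.
Proof.
move=> e0; have L0 : (0 <= L2norm mu f)%E by exact: Lnorm_ge0.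
have mem (x : \bar R) : (0 <= x)%E -> x \in `[0%E, +oo%E].
  by move=> x0; rewrite in_itv/= x0 leey.
apply/idP/idP => h.
  rewrite -L2norm_sqr -powR_mulrn// -poweR_EFin.
  by apply: gt0_ler_poweR => //; exact: mem.
rewrite L2normE.
have -> : e%:E = ((e ^+ 2)%:E `^ 2^-1)%E.
  by rewrite -powR_mulrn// -poweR_EFin -poweRrM mulfV// poweRe1.
by apply: gt0_ler_poweR => //; apply: mem => //;
  [exact: energy_ge0|rewrite lee_fin sqr_ge0].
Qed.

Lemma eq_energy f g : cmeasurable f -> cmeasurable g -> f = g %[ae mu] ->
  energy f = energy g.
Proof.
move=> mf mg fg; apply: ge0_ae_eq_integral => //; try exact: measurable_nsq;
  try by move=> x _; rewrite lee_fin nsq_ge0.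
by apply: filterS fg => x /= /(_ I) ->.
Qed.

Lemma energy_eq0 f : cmeasurable f -> energy f = 0%E -> f = (fun=> 0) %[ae mu].
Proof.
move=> mf f0; have /ae_eq_integral_abs : (\int[mu]_x `|(nsq (f x))%:E| = 0)%E.
  by rewrite -[RHS]f0; apply: eq_integral => x _; rewrite gee0_abs// lee_fin nsq_ge0.
move=> /(_ measurableT (measurable_nsq mf)); apply: filterS => x h /= _.
by apply: nsq_eq0; have /(_ I) [] := h.
Qed.

Lemma energyD_le f g : cmeasurable f -> cmeasurable g ->
  (energy (fun x => (f x + g x)%R) <= 2%:E * (energy f + energy g))%E.
Proof.
move=> mf mg; have nsqf0 h x : (0 <= (nsq (h x : R[i]))%:E)%E.
  by rewrite lee_fin nsq_ge0.
rewrite -ge0_integralD//; try exact: measurable_nsq.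
rewrite -ge0_integralZl//; last 2 first.
- by apply: emeasurable_funD; exact: measurable_nsq.
- by move=> x _; rewrite adde_ge0.
apply: ge0_le_integral => //.
- exact/measurable_nsq/cmeasurableD.
- by apply: emeasurable_funM => //; apply: emeasurable_funD; exact: measurable_nsq.
- by move=> x _; rewrite -EFinD -EFinM lee_fin nsqD_le.
Qed.

Lemma energyZ (c : R[i]) f : cmeasurable f ->
  energy (fun x => c * f x) = ((nsq c)%:E * energy f)%E.
Proof.
move=> mf; rewrite /energy; under eq_integral do rewrite nsqM EFinM.
rewrite ge0_integralZl//; [exact: measurable_nsq| |by rewrite lee_fin nsq_ge0].
by move=> x _; rewrite lee_fin nsq_ge0.
Qed.

Lemma energyN f : energy (fun x => - f x) = energy f.
Proof. by apply: eq_integral => x _; rewrite nsqN. Qed.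

Lemma energyB_sym f g :
  energy (fun x => f x - g x) = energy (fun x => g x - f x).
Proof. by rewrite -energyN; apply: eq_integral => x _; rewrite opprB. Qed.

End energy.

(** * Strong limits *)

Section energy_convergence.
Context d (T : measurableType d) (R : realType).
Variable mu : {measure set T -> \bar R}.
Implicit Types (f g : T -> R[i]) (h : nat -> T -> R[i]).
Local Notation energy := (energy mu).

Definition econv h g := forall e : R, 0 < e -> exists N, forall n, (N <= n)%N ->
  (energy (fun x => h n x - g x)%R <= e%:E)%E.

Lemma L2norm_cvg0P h g :
  (fun n => L2norm mu (fun x => h n x - g x)) @ \oo --> 0%E <-> econv h g.
Proof.
have L0 n : (0 <= L2norm mu (fun x => h n x - g x)%R)%E by exact: Lnorm_ge0.
split=> [/fine_cvgP[fin /cvgr0Pnorm_le c] e e0|c].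
  have se0 : 0 < Num.sqrt e by rewrite sqrtr_gt0.
  have [N _ NP] : \forall n \near \oo,
      (L2norm mu (fun x => h n x - g x)%R <= (Num.sqrt e)%:E)%E.
    near=> n.
    rewrite -(fineK (_ : L2norm _ _ \is a fin_num)); last by near: n.
    rewrite lee_fin; apply: le_trans (ler_norm _) _; near: n; exact: c.
  exists N => n Nn; have := NP n Nn.
  by rewrite L2norm_le ?sqrtr_ge0// sqr_sqrtr// ltW.
have bnd (e : R) : 0 < e -> \forall n \near \oo,
    (L2norm mu (fun x => h n x - g x)%R <= e%:E)%E.
  move=> e0; have [|N NP] := c (e ^+ 2); first by rewrite exprn_gt0.
  exists N => // n Nn /=; rewrite (L2norm_le _ _ (ltW e0)); exact: NP.
have fin : \forall n \near \oo,
    L2norm mu (fun x => h n x - g x)%R \is a fin_num.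
  near=> n; rewrite ge0_fin_numE//.
  apply: (@le_lt_trans _ _ 1%:E); last exact: ltry.
  by near: n; apply: bnd.
apply/fine_cvgP; split=> //; apply/cvgr0Pnorm_le => e e0.
near=> n; rewrite /= ger0_norm; last by rewrite fine_ge0.
by rewrite -lee_fin fineK; [near: n; exact: bnd|near: n].
Unshelve. all: by end_near.
Qed.

Lemma energy_sub_le f g k : cmeasurable f -> cmeasurable g -> cmeasurable k ->
  (energy (fun x => f x - g x)%R <=
   2%:E * (energy (fun x => k x - f x)%R + energy (fun x => k x - g x)%R))%E.
Proof.
move=> mf mg mk; rewrite (energyB_sym mu k f).
rewrite (_ : (fun x => f x - g x) = (fun x => (f x - k x) + (k x - g x)));
  last by apply/funext => x; rewrite addrA subrK.
by apply: energyD_le; exact: cmeasurableB.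
Qed.

Lemma energy_le_sub f k : cmeasurable f -> cmeasurable k ->
  (energy f <= 2%:E * (energy (fun x => k x - f x)%R + energy k))%E.
Proof.
move=> mf mk; rewrite energyB_sym.
rewrite {1}(_ : f = (fun x => (f x - k x) + k x));
  last by apply/funext => x; rewrite subrK.
by apply: energyD_le => //; exact: cmeasurableB.
Qed.

Lemma econv_unique h f g : (forall n, cmeasurable (h n)) ->
  cmeasurable f -> cmeasurable g -> econv h f -> econv h g -> f = g %[ae mu].
Proof.
move=> mh mf mg hf hg.
have /(energy_eq0 (cmeasurableB mf mg)) : energy (fun x => f x - g x) = 0%E.
  apply/eqP; rewrite eq_le energy_ge0 andbT; apply/lee_addgt0Pr => e e0.
  have [|N1 h1] := hf (e / 4); first by rewrite divr_gt0.
  have [|N2 h2] := hg (e / 4); first by rewrite divr_gt0.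
  rewrite add0e; apply: le_trans (energy_sub_le mf mg (mh (maxn N1 N2))) _.
  apply: (@le_trans _ _ (2%:E * ((e / 4)%:E + (e / 4)%:E))%E).
    apply: lee_wpmul2l => //; apply: leeD; [apply: h1|apply: h2].
      exact: leq_maxl.
    exact: leq_maxr.
  by rewrite -EFinD -EFinM lee_fin; lra.
by apply: filterS => x /= h0 I; apply/eqP; rewrite -subr_eq0 h0.
Qed.

Lemma econvD (c : R[i]) h1 h2 g1 g2 :
  (forall n, cmeasurable (h1 n)) -> (forall n, cmeasurable (h2 n)) ->
  cmeasurable g1 -> cmeasurable g2 -> econv h1 g1 -> econv h2 g2 ->
  econv (fun n x => c * h1 n x + h2 n x) (fun x => c * g1 x + g2 x).
Proof.
(* Adding 1 keeps the divisor positive when c = 0 and still makes nsq c / k less than 1. *)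
move=> m1 m2 mg1 mg2 c1 c2 e e0; have [k kE] : exists k, k = nsq c + 1 by eexists.
have k0 : 0 < k by rewrite kE ltr_wpDl// nsq_ge0.
have [|N1 h1P] := c1 (e / (4 * k)); first by rewrite divr_gt0// mulr_gt0.
have [|N2 h2P] := c2 (e / 4); first by rewrite divr_gt0.
exists (maxn N1 N2) => n; rewrite geq_max => /andP[/h1P h1n /h2P h2n].
rewrite (_ : (fun x => _) = fun x =>
  c * (h1 n x - g1 x) + (h2 n x - g2 x)); last by apply/funext => x; ring.
apply: le_trans (energyD_le mu _ _) _.
- by apply: cmeasurableM; [exact: cmeasurable_cst|exact: cmeasurableB].
- exact: cmeasurableB.
rewrite energyZ; last exact: cmeasurableB.
apply: (@le_trans _ _ (2 * (nsq c * (e / (4 * k)) + e / 4))%:E).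
  rewrite (EFinM 2) (EFinD (nsq c * _)) (EFinM (nsq c)).
  apply: lee_wpmul2l => //; apply: leeD => //.
  by apply: lee_wpmul2l => //; rewrite lee_fin nsq_ge0.
rewrite lee_fin.
have -> : nsq c * (e / (4 * k)) = e / 4 - e / (4 * k).
  have -> : nsq c = k - 1 by rewrite kE addrK.
  by field; rewrite gt_eqF.
have : 0 < e / (4 * k) by rewrite divr_gt0// mulr_gt0.
lra.
Qed.

(** The energy of a difference is the sum of the squared distances of the real and of the imaginary
    parts, so real completeness applies to each part. *)
Lemma econv_complete h : (forall n, cmeasurable (h n)) ->
  (forall e : R, 0 < e -> exists N, forall m n, (N <= m)%N -> (N <= n)%N ->
     (energy (fun x => h m x - h n x)%R <= e%:E)%E) ->
  exists2 g, cmeasurable g & econv h g.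
Proof.
move=> mh cau.
have split_energy f g : cmeasurable f -> cmeasurable g ->
  energy (fun x => f x - g x) =
  (\int[mu]_x ((complex.Re (f x) - complex.Re (g x)) ^+ 2)%:E +
   \int[mu]_x ((complex.Im (f x) - complex.Im (g x)) ^+ 2)%:E)%E.
  move=> [f1 f2] [g1 g2]; rewrite -ge0_integralD//.
  - by apply: eq_integral => x _; rewrite /nsq ReD ImD ReN ImN.
  - by move=> x _; rewrite lee_fin sqr_ge0.
  - by apply/measurable_EFinP/measurable_funX; exact: measurable_funB.
  - by move=> x _; rewrite lee_fin sqr_ge0.
  - by apply/measurable_EFinP/measurable_funX; exact: measurable_funB.
have int_ge0 (a b : T -> R) : (0 <= \int[mu]_x ((a x - b x) ^+ 2)%:E)%E.
  by apply: integral_ge0 => x _; rewrite lee_fin sqr_ge0.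
have [||u mu_ cu] := @L2_complete _ _ _ mu (fun n x => complex.Re (h n x)).
- by move=> n; have [] := mh n.
- move=> e /cau[N NP]; exists N => m n Nm Nn; apply: le_trans (NP m n Nm Nn).
  by rewrite split_energy//; exact: leeDl.
have [||v mv cv] := @L2_complete _ _ _ mu (fun n x => complex.Im (h n x)).
- by move=> n; have [] := mh n.
- move=> e /cau[N NP]; exists N => m n Nm Nn; apply: le_trans (NP m n Nm Nn).
  by rewrite split_energy//; exact: leeDr.
exists (fun x => u x +i* v x) => // e e0.
have [|N1 h1] := cu (e / 2); first by rewrite divr_gt0.
have [|N2 h2] := cv (e / 2); first by rewrite divr_gt0.
exists (maxn N1 N2) => n; rewrite geq_max => /andP[/h1 {}h1 /h2 {}h2].
rewrite split_energy//= (splitr e) EFinD; exact: leeD.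
Qed.

End energy_convergence.

Section strong_limits.
Context d (T : measurableType d) (R : realType).
Variable mu : {measure set T -> \bar R}.
Local Notation energy := (energy mu).
Local Notation op := ((T -> R[i]) -> T -> R[i]).

Lemma is_slimP (P : nat -> op) (A : op) : is_slim mu P A <->
  bounded_operator mu A /\ forall f, L2 mu f -> econv mu (P^~ f) (A f).
Proof.
split=> [[bA cA]|[bA cA]]; split=> // f /cA; first by move/L2norm_cvg0P.
by move=> ?; apply/L2norm_cvg0P.
Qed.

Lemma slimP (P : nat -> op) : slim_exists mu P -> is_slim mu P (slim mu P).
Proof. by rewrite /slim; case: pselect => // e _; case: cid. Qed.

(** Equality at every point. Finite averages of transports satisfy it; a strong limit is linear only
    up to null sets. *)
Definition linear_op (A : op) := forall (c : R[i]) f g,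
  A (fun x => c * f x + g x) = (fun x => c * A f x + A g x).

Definition energy_contraction (A : op) := forall f, cmeasurable f ->
  cmeasurable (A f) /\ (energy (A f) <= energy f)%E.

Lemma linear_opB (A : op) f g : linear_op A ->
  A (fun x => f x - g x) = (fun x => A f x - A g x).
Proof.
move=> lA; transitivity (A (fun x => (-1) * g x + f x)).
  by congr A; apply/funext => x; rewrite mulN1r addrC.
by rewrite lA; apply/funext => x; rewrite mulN1r addrC.
Qed.

Lemma linear_op0 (A : op) : linear_op A -> A (fun=> 0) = (fun=> 0).
Proof.
move=> lA; rewrite (_ : (fun=> 0) = (fun x : T => 0 - 0)); last first.
  by apply/funext => x; rewrite subrr.
by rewrite (linear_opB (fun=> 0) (fun=> 0) lA); apply/funext => x; rewrite !subrr.
Qed.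

Lemma linear_opZ (A : op) (c : R[i]) f : linear_op A ->
  A (fun x => c * f x) = (fun x => c * A f x).
Proof.
move=> lA; have := lA c f (fun=> 0); rewrite linear_op0//.
by under eq_fun do rewrite addr0; under [in RHS]eq_fun do rewrite addr0.
Qed.

Lemma linear_op_sum (A : op) (I : Type) (s : seq I) (F : I -> T -> R[i]) :
  linear_op A ->
  A (fun x => \sum_(i <- s) F i x) = (fun x => \sum_(i <- s) A (F i) x).
Proof.
move=> lA; elim: s => [|i s IH].
  under eq_fun do rewrite big_nil; rewrite linear_op0//.
  by apply/funext => x; rewrite big_nil.
rewrite (_ : (fun x => _) = (fun x => 1 * F i x + \sum_(j <- s) F j x)).
  by rewrite lA IH; apply/funext => x; rewrite big_cons mul1r.
by apply/funext => x; rewrite big_cons mul1r.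
Qed.

(** The difference f - g has energy 0, hence so does its image. *)
Lemma contraction_ae (A : op) f g : linear_op A -> energy_contraction A ->
  cmeasurable f -> cmeasurable g -> f = g %[ae mu] -> A f = A g %[ae mu].
Proof.
move=> lA cA mf mg fg; have mfg := cmeasurableB mf mg.
have e0 : energy (fun x => f x - g x) = 0%E.
  have -> : 0%E = energy (fun=> 0).
    by rewrite /energy integral0_eq// => x _; rewrite /nsq/= expr0n/= addr0.
  apply: eq_energy => //.
  by apply: filterS fg => x /= /(_ I) -> _; rewrite subrr.
have [mA] := cA _ mfg; rewrite e0 => leA.
have /(energy_eq0 mA) : energy (A (fun x => f x - g x)) = 0%E.
  by apply/eqP; rewrite eq_le leA energy_ge0.
rewrite linear_opB//; apply: filterS => x /= h0 I.
by apply/eqP; rewrite -subr_eq0 h0.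
Qed.

Lemma L2_lin (c : R[i]) f g : L2 mu f -> L2 mu g ->
  L2 mu (fun x => c * f x + g x).
Proof.
move=> /L2P[mf Ef] /L2P[mg Eg].
have mcf : cmeasurable (fun x => c * f x).
  by apply: cmeasurableM => //; exact: cmeasurable_cst.
apply/L2P; split; first exact: cmeasurableD.
apply: le_lt_trans (energyD_le mu mcf mg) _; rewrite energyZ//.
case: (energy f) (energy_ge0 mu f) Ef => // a _ _.
case: (energy g) (energy_ge0 mu g) Eg => // b _ _.
exact: (ltry (2 * (nsq c * a + b))).
Qed.

(** By the Pythagoras hypothesis the numbers [energy (P n f)] decrease, and the squared distance of
    two terms is the drop between them. Being bounded below by 0 they converge, so the sequence P n
    f is Cauchy. *)
Lemma slim_exists_projections (P : nat -> op) :
  (forall n, linear_op (P n)) -> (forall n, energy_contraction (P n)) ->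
  (forall r s f, (r <= s)%N -> cmeasurable f ->
     energy (fun x => P r f x - P s f x)%R + energy (P s f) = energy (P r f))%E ->
  slim_exists mu P.
Proof.
move=> lP cP pyth.
have mP n f : cmeasurable f -> cmeasurable (P n f) by move=> /(cP n)[].
have lim f : L2 mu f -> exists2 g, cmeasurable g & econv mu (P^~ f) g.
  move=> /L2P[mf Ef]; apply: econv_complete => [n|e e0]; first exact: mP.
  have fin n : energy (P n f) \is a fin_num.
    rewrite ge0_fin_numE ?energy_ge0//; have [_] := cP n _ mf.
    by move=> /le_lt_trans; apply.
  pose a n := fine (energy (P n f)).
  have a_dec : {homo a : n m / (n <= m)%N >-> m <= n}.
    move=> r s rs; rewrite /a -lee_fin !fineK// -(pyth _ _ _ rs mf).
    by apply: leeDr; exact: energy_ge0.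
  have a_cvg : cvgn a.
    apply: nonincreasing_is_cvgn => //; exists 0 => _ [n _ <-].
    by apply: fine_ge0; exact: energy_ge0.
  have [N _ NP] : \forall n \near \oo, `|limn a - a n| <= e.
    by move/cvgrPdist_le : a_cvg; apply.
  have le_e r s : (N <= r)%N -> (r <= s)%N ->
      (energy (fun x => P r f x - P s f x)%R <= e%:E)%E.
    move=> Nr rs; have := pyth r s f rs mf.
    rewrite -(fineK (fin r)) -(fineK (fin s)) -/(a r) -/(a s).
    have := NP r Nr; have := nonincreasing_cvgn_ge a_dec a_cvg s.
    have := nonincreasing_cvgn_ge a_dec a_cvg r.
    move=> lr ls; rewrite /= distrC ger0_norm ?subr_ge0// => le_e.
    case: (energy _) (energy_ge0 mu (fun x => P r f x - P s f x)%R) => // b b0.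
    by rewrite -EFinD => -[]; rewrite lee_fin; lra.
  exists N => m n Nm Nn; have [mn|/ltnW nm] := leqP m n; first exact: le_e.
  by rewrite energyB_sym; exact: le_e.
(* Outside [L2] the value is arbitrary. On [L2] limits are chosen one function at a time, so
   linearity and compatibility with equality almost everywhere must come from uniqueness of
   limits. *)
have /choice[A AP] : forall f, exists g, L2 mu f ->
    cmeasurable g /\ econv mu (P^~ f) g.
  move=> f; have [/lim[g mg cg]|nf] := pselect (L2 mu f); first by exists g.
  by exists f.
(* The crude inequality [energy_le_sub] yields the factor 2 as the error tends to 0; it is relaxed
   to 4, a square, so that the norm bound is 2. *)
have AE f : L2 mu f -> (energy (A f) <= 4%:E * energy f)%E.
  move=> L2f; have [mA cA] := AP f L2f; have /L2P[mf Ef] := L2f.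
  have [N NP] := cA 1 ltr01.
  have : (energy (A f) <= 2%:E * (energy f + energy f))%E; last first.
    case: (energy f) (energy_ge0 mu f) Ef => // a a0 _.
    by rewrite -EFinD -!EFinM; congr (_ <= _%:E)%E; ring.
  have bnd e : 0 < e -> (energy (A f) <= 2%:E * (e%:E + energy f))%E.
    move=> e0; have [M MP] := cA e e0.
    apply: le_trans (energy_le_sub mu mA (mP M _ mf)) _.
    apply: lee_wpmul2l => //; apply: leeD; first exact: MP.
    by have [] := cP M _ mf.
  case: (energy f) (energy_ge0 mu f) Ef bnd => // a a0 _ bnd.
  apply/lee_addgt0Pr => e e0.
  apply: le_trans (bnd (e / 2) _) _; first by rewrite divr_gt0.
  have : 2 * (e / 2 + a) <= 2 * (a + a) + e by move: a0; rewrite lee_fin; lra.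
  by rewrite -lee_fin.
have AL2 f : L2 mu f -> L2 mu (A f).
  move=> L2f; have [mA _] := AP f L2f; have /L2P[mf Ef] := L2f.
  apply/L2P; split=> //; apply: le_lt_trans (AE f L2f) _.
  by case: (energy f) (energy_ge0 mu f) Ef => // a _ _; rewrite -EFinM ltry.
exists A; apply/is_slimP; split; last by move=> f /AP[].
split=> //.
- move=> f g /[dup] /L2P[mf _] /AP[mAf cAf] /[dup] /L2P[mg _] /AP[mAg cAg] fg.
  apply: (@econv_unique _ _ _ mu (P^~ f)) => //; first by move=> n; exact: mP.
  move=> e /cAg[N NP]; exists N => n Nn; apply: le_trans (NP n Nn).
  rewrite (@eq_energy _ _ _ mu _ (fun x => P n g x - A g x))//.
  + by apply: cmeasurableB => //; exact: mP.
  + by apply: cmeasurableB => //; exact: mP.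
  apply: filterS (contraction_ae (lP n) (cP n) mf mg fg).
  by move=> x /= /[apply] ->.
- move=> c f g L2f L2g.
  have [mAf cAf] := AP f L2f; have [mAg cAg] := AP g L2g.
  have /L2P[mf Ef] := L2f; have /L2P[mg Eg] := L2g.
  have L2fg := L2_lin c L2f L2g.
  have [mA cA] := AP _ L2fg.
  apply: (@econv_unique _ _ _ mu (P^~ (fun x => c * f x + g x))) => //.
  + by move=> n; apply: mP; have /L2P[] := L2fg.
  + apply: cmeasurableD => //.
    by apply: cmeasurableM => //; exact: cmeasurable_cst.
  + under [X in econv _ X _]eq_fun do rewrite lP.
    by apply: econvD => // n; exact: mP.
- exists 2 => f L2f; have := AE f L2f.
  have /L2P[mf Ef] := L2f.
  have : L2norm mu f \is a fin_num.
    by rewrite ge0_fin_numE ?Lnorm_ge0//; have [] := L2f.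
  have := Lnorm_ge0 mu 2%:E (fun x => (Normc.normc (f x))%:E).
  rewrite -/(L2norm mu f) => L0 /fineK LE.
  rewrite -LE -EFinM L2norm_le; last by rewrite mulr_ge0// fine_ge0.
  rewrite -[energy f]L2norm_sqr -LE poweR_EFin powR_mulrn ?fine_ge0//.
  by rewrite -EFinM exprMn -natrX.
Qed.

(** For large n the common value of P n (U f) and U (P n f) tends to A (U f), and also to U (A f)
    because U does not increase energy; limits are unique up to null sets. *)
Lemma slim_commute (P : nat -> op) (A U : op) :
  (forall n f, cmeasurable f -> cmeasurable (P n f)) ->
  is_slim mu P A -> linear_op U -> energy_contraction U ->
  (exists N, forall n f, (N <= n)%N -> P n (U f) = U (P n f)) ->
  forall f, L2 mu f -> A (U f) = U (A f) %[ae mu].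
Proof.
move=> mP /is_slimP[bA cA] lU cU [N NP] f L2f; have [A2 _ _ _] := bA.
have /L2P[mf Ef] := L2f; have /L2P[mAf _] := A2 f L2f.
have [mUf EUf] := cU f mf.
have L2Uf : L2 mu (U f) by apply/L2P; split=> //; exact: le_lt_trans Ef.
have /L2P[mAUf _] := A2 _ L2Uf; have [mUAf _] := cU _ mAf.
apply: (@econv_unique _ _ _ mu (fun n => P n (U f))) => //.
- by move=> n; exact: mP.
- exact: cA.
move=> e e0; have [M MP] := cA f L2f e e0.
exists (maxn N M) => n; rewrite geq_max => /andP[Nn Mn].
rewrite NP// -linear_opB//; apply: le_trans (MP n Mn).
by have [] := cU _ (cmeasurableB (mP n _ mf) mAf).
Qed.

Lemma bounded_operator_comp (A B : op) : bounded_operator mu A ->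
  bounded_operator mu B -> bounded_operator mu (A \o B).
Proof.
move=> [A1 A2 A3 [a A4]] [B1 B2 B3 [b B4]]; split=> /=.
- by move=> f /B1/A1.
- by move=> f g Lf Lg fg; apply: A2; [exact: B1|exact: B1|exact: B2].
- move=> c f g Lf Lg; have Lc := L2_lin c Lf Lg.
  have Lb := L2_lin c (B1 _ Lf) (B1 _ Lg).
  have h1 := A2 _ _ (B1 _ Lc) Lb (B3 c f g Lf Lg).
  have h2 := A3 c _ _ (B1 _ Lf) (B1 _ Lg).
  by apply: filterS2 h1 h2 => x /= e1 e2 I; rewrite e1// e2.
(* The constants in [bounded_operator] may be negative, hence the absolute values. *)
- exists (`|a| * `|b|) => f Lf.
  apply: le_trans (A4 _ (B1 _ Lf)) _.
  have L0 g : (0 <= L2norm mu g)%E by exact: Lnorm_ge0.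
  apply: (@le_trans _ _ (`|a|%:E * L2norm mu (B f))%E).
    by apply: lee_wpmul2r => //; rewrite lee_fin ler_norm.
  rewrite EFinM -muleA; apply: lee_wpmul2l => //.
  apply: le_trans (B4 _ Lf) _; apply: lee_wpmul2r => //.
  by rewrite lee_fin ler_norm.
Qed.

Lemma bounded_operator_id : bounded_operator mu id.
Proof.
split=> //; first by move=> c f g _ _; exact: ae_eq_refl.
by exists 1 => f _; rewrite mul1e.
Qed.

End strong_limits.

(** * Densities of finite-range transformations of a product measure *)

Section densities.
Context d (T : measurableType d) (R : realType).

(** Packages the integral of w as a measure, so that a candidate density can be checked on cylinders
    by uniqueness of measures. *)
Lemma density_measure (mu : {measure set T -> \bar R}) (w : T -> \bar R) :
  measurable_fun setT w -> (forall x, 0 <= w x)%E ->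
  exists nu : {measure set T -> \bar R},
    forall A, nu A = (\int[mu]_(x in A) w x)%E.
Proof.
move=> mw w0; pose nu (A : set T) := (\int[mu]_(x in A) w x)%E.
have nu0 : nu set0 = 0%E by exact: integral_set0.
have nu_ge0 A : (0 <= nu A)%E by exact: integral_ge0.
have nu_sigma : semi_sigma_additive nu.
  move=> F mF tF mUF; rewrite /nu ge0_integral_bigcup//.
    by apply: is_cvg_nneseries => n _ _; exact: integral_ge0.
  exact: measurable_funTS.
pose m := isMeasure.Build _ _ _ nu nu0 nu_ge0 nu_sigma.
pose numeas : {measure set T -> \bar R} := HB.pack nu m.
by exists numeas.
Qed.

Lemma measurable_Radon_Nikodym (nu : {charge set T -> \bar R})
    (mu : {sigma_finite_measure set T -> \bar R}) :
  measurable_fun setT ('d nu '/d mu).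
Proof.
have [numu|nnumu] := pselect (nu `<< mu).
  exact: measurable_int (Radon_Nikodym_integrable numu).
by rewrite /Radon_Nikodym; case: pselect => // _; exact: measurable_cst.
Qed.

Variable mu : probability T R.
Variables (S : {mfun T >-> T}) (w : T -> R).
Hypothesis mw : measurable_fun setT w.
Hypothesis w0 : forall x, 0 <= w x.
Hypothesis Sw : forall A, measurable A ->
  mu (S @^-1` A) = (\int[mu]_(x in A) (w x)%:E)%E.

Let nu := distribution mu S.

Let mwE : measurable_fun setT (EFin \o w).
Proof. exact/measurable_EFinP. Qed.

Let nu_mu : nu `<< mu.
Proof.
move=> N N0 A mA AN; rewrite /nu /distribution /pushforward Sw//.
by apply: null_set_integral => //; [exact: measurable_funTS|exact: N0].
Qed.

Lemma Radon_Nikodym_density :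
  'd (charge_of_finite_measure nu) '/d mu = EFin \o w %[ae mu].
Proof.
apply: integral_ae_eq => //; first exact: Radon_Nikodym_integrable.
by move=> A _ mA; rewrite -Radon_Nikodym_integral//=; exact: Sw.
Qed.

Lemma integral_density (F : T -> \bar R) : measurable_fun setT F ->
  (forall x, 0 <= F x)%E ->
  (\int[mu]_x (F x * (w x)%:E) = \int[mu]_x F (S x))%E.
Proof.
move=> mF F0; rewrite -[RHS](@ge0_integral_pushforward _ _ _ _ _ S _ mu setT)//.
have mRN := measurable_int _ (Radon_Nikodym_SigmaFinite.f_integrable nu_mu).
transitivity (\int[nu]_x F x)%E => //.
rewrite -(Radon_Nikodym_SigmaFinite.change_of_variables nu_mu F0 measurableT mF).
apply: ge0_ae_eq_integral => //.
- exact: emeasurable_funM.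
- exact: emeasurable_funM.
- by move=> x _; rewrite mule_ge0 ?lee_fin.
- by move=> x _; rewrite mule_ge0//; exact: Radon_Nikodym_SigmaFinite.f_ge0.
(* The change of variables speaks of another version of the derivative; the two versions and w agree
   almost everywhere. *)
have := ae_eq_Radon_Nikodym_SigmaFinite nu_mu measurableT.
apply: filterS2 Radon_Nikodym_density => x /= e1 e2 _.
by rewrite e2// e1.
Qed.

End densities.

(** * Cylinder sets and uniqueness of measures on them *)

Section cylinders.
Context (R : realType) (p : nat) (I : eqType).
Local Notation X := (conf p I).

Definition cyl (s : seq I) (x : X) : set X := [set y | {in s, forall i, y i = x i}].

Lemma cyl_cons i s (x : X) : cyl (i :: s) x = [set y | y i = x i] `&` cyl s x.
Proof.
apply/seteqP; split=> [y h|y [h1 h2] j].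
  by split=> [|j js]; apply: h; rewrite inE ?eqxx// js orbT.
by rewrite inE => /orP[/eqP->//|]; exact: h2.
Qed.

Lemma measurable_coord (i : I) (r : 'F_p) : measurable [set y : X | y i = r].
Proof. by apply: sub_sigma_algebra; exists i => //; exists r. Qed.

Lemma measurable_cyl s (x : X) : measurable (cyl s x).
Proof.
elim: s => [|i s IH]; first by rewrite (_ : cyl _ _ = setT)//; apply/seteqP.
by rewrite cyl_cons; apply: measurableI => //; exact: measurable_coord.
Qed.

(** A cylinder over s is the finite disjoint union, over the values at i, of cylinders over i ::
    s. *)
Lemma eq_measure_cyl_cons (m1 m2 : {measure set X -> \bar R}) i s :
  (forall x, m1 (cyl (i :: s) x) = m2 (cyl (i :: s) x)) ->
  forall x, m1 (cyl s x) = m2 (cyl s x).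
Proof.
move=> h x; have [si|nsi] := boolP (i \in s).
  rewrite (_ : cyl s x = cyl (i :: s) x)// cyl_cons.
  by apply/seteqP; split=> [y h1|y []//]; split=> //=; exact: h1.
pose x_ r : X := fun j => if j == i then r else x j.
have -> : cyl s x = \bigcup_(r in [set: 'F_p]) cyl (i :: s) (x_ r).
  apply/seteqP; split=> [y h1|y [r _]].
    exists (y i) => // j; rewrite inE /x_; case: eqP => [-> //|_ /=].
    exact: h1.
  rewrite cyl_cons => -[_ h1] j js; rewrite h1// /x_.
  by case: eqP js nsi => // -> ->.
have tr : trivIset [set: 'F_p] (fun r => cyl (i :: s) (x_ r)).
  move=> r r' _ _ [y []]; rewrite !cyl_cons /x_ => -[/= + _] [/= + _].
  by rewrite eqxx => -> ->.
have fin : finite_set [set: 'F_p] by exact: finite_finset.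
rewrite !measure_fin_bigcup//; try by move=> *; exact: measurable_cyl.
by apply: eq_fsbigr => r _; exact: h.
Qed.

(** Cylinders form a pi-system generating the sigma-algebra, and by additivity it is enough to test
    those that fix all coordinates in [J]. On such cylinders a function of the coordinates in [J] is
    constant. *)
Lemma eq_measure_cyl (m1 m2 : {measure set X -> \bar R}) (J : seq I) :
  (m1 setT < +oo)%E ->
  (forall s x, uniq s -> {subset J <= s} -> m1 (cyl s x) = m2 (cyl s x)) ->
  forall A, measurable A -> m1 A = m2 A.
Proof.
move=> m1oo h A mA.
have hc s x : m1 (cyl s x) = m2 (cyl s x).
  suff : forall J' s, (forall x, m1 (cyl (J' ++ s) x) = m2 (cyl (J' ++ s) x)) ->
      forall x, m1 (cyl s x) = m2 (cyl s x).
    apply => {}x; rewrite (_ : cyl _ x = cyl (undup (J ++ s)) x); last first.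
      by apply/seteqP; split=> y hy j; [rewrite mem_undup|rewrite -mem_undup]; exact: hy.
    apply: h; first exact: undup_uniq.
    by move=> j jJ; rewrite mem_undup mem_cat jJ.
  by elim=> // j J' IH s' h'; apply: IH; exact: eq_measure_cyl_cons h'.
(* The empty set is added because cylinders with conflicting values are disjoint. *)
pose G := [set A : set X | A = set0 \/ exists s x, A = cyl s x].
apply: (@measure_unique _ _ _ G (fun=> setT)) => //.
- apply/seteqP; split.
    apply: smallest_sub; first exact: smallest_sigma_algebra.
    move=> _ [i _ [r _ <-]]; apply: sub_sigma_algebra; right.
    exists [:: i], (fun=> r); rewrite cyl_cons; apply/seteqP.
    by split=> y //=; case.
  apply: smallest_sub; first exact: sigma_algebra_measurable.
  by move=> _ [->//|[s [x ->]]]; exact: measurable_cyl.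
- move=> B C [->|[s [x ->]]]; first by left; rewrite set0I.
  move=> [->|[s' [x' ->]]]; first by left; rewrite setI0.
  have [[z [zx zx']]|ne] := pselect (cyl s x `&` cyl s' x' !=set0).
    right; exists (s ++ s'), z; apply/seteqP; split.
      move=> y [h1 h2] j; rewrite mem_cat => /orP[js|js].
        by rewrite h1// zx.
      by rewrite h2// zx'.
    move=> y h1; split=> j js; rewrite h1 ?mem_cat ?js ?orbT//.
      exact: zx.
    exact: zx'.
  by left; apply/seteqP; split=> // y hy; apply: ne; exists y.
- move=> _; right; exists [::], (fun=> 0); by apply/seteqP.
- by rewrite bigcup_const.
- by move=> _ [->|[s [x ->]]]; [rewrite !measure0|exact: hc].
Qed.

End cylinders.

Lemma measurable_prod_coord (R : realType) (p : nat) (I : eqType)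
    (g : I -> 'F_p -> R) (J : seq I) :
  measurable_fun setT (fun x : conf p I => \prod_(i <- J) g i (x i)).
Proof.
apply: measurable_prod => i _.
(* A function of one coordinate takes finitely many values and is a combination of indicators. *)
have -> : (fun x : conf p I => g i (x i)) =
    (fun x => \sum_(r : 'F_p) g i r * \1_[set y : conf p I | y i = r] x).
  apply/funext => x; rewrite (bigD1 (x i))//= big1 ?addr0.
    by rewrite indicE mem_set// mulr1.
  move=> r rx; rewrite indicE memNset ?mulr0//= => e.
  by rewrite e eqxx in rx.
apply: measurable_sum => r; apply: measurable_funM => //.
by apply: measurable_indic; exact: measurable_coord.
Qed.

Section local_transformations.
Context (R : realType) (p : nat) (I : eqType).
Local Notation X := (conf p I).
Variables (a : I -> 'F_p -> R) (mu : probability X R).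
Hypothesis a_gt0 : forall i r, 0 < a i r.
Hypothesis muE : is_product_measure a mu.

Definition weight (J : seq I) (x : X) : R := \prod_(i <- J) a i (x i).

Lemma weight_gt0 J x : 0 < weight J x.
Proof. by apply: prodr_gt0 => i _; exact: a_gt0. Qed.

Lemma measurable_weight J : measurable_fun setT (weight J).
Proof. exact: measurable_prod_coord. Qed.

Lemma measurable_weightV J : measurable_fun setT (fun x => (weight J x)^-1).
Proof.
under eq_fun do rewrite -prodfV.
exact: (measurable_prod_coord (fun i r => (a i r)^-1)).
Qed.

(** These conditions say that S permutes the coordinates-in-[J] part of a point independently of the
    rest. Hence the preimage of a cylinder over a list containing [J] is again a cylinder over that
    list. *)
Definition local_inverse (J : seq I) (S S' : X -> X) :=
  [/\ cancel S S', cancel S' S,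
      forall x i, i \notin J -> S' x i = x i,
      forall x y, {in J, x =1 y} -> {in J, S' x =1 S' y} &
      forall x y, {in J, x =1 y} -> {in J, S x =1 S y}].

(** On a cylinder through x over a list containing [J] the quotient is constant, and the preimage is
    the cylinder through S' x. The product formula gives both measures, and the factors outside [J]
    agree. *)
Lemma local_density J (S : {mfun X >-> X}) (S' : X -> X) : uniq J ->
  measurable_fun setT S' -> local_inverse J S S' ->
  forall A, measurable A ->
  mu (S @^-1` A) = (\int[mu]_(x in A) (weight J (S' x) / weight J x)%:E)%E.
Proof.
move=> uJ mS' [SK S'K S'out S'loc Sloc].
have Sout x i : i \notin J -> S x i = x i.
  by move=> iJ; rewrite -[in RHS](SK x) S'out.
have mw : measurable_fun setT (fun x => (weight J (S' x) / weight J x)%:E).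
  apply/measurable_EFinP; apply: measurable_funM.
    by apply: measurableT_comp => //; exact: measurable_weight.
  exact: measurable_weightV.
have w0 x : (0 <= (weight J (S' x) / weight J x)%:E)%E.
  by rewrite lee_fin divr_ge0// ltW// weight_gt0.
have [nu nuE] := density_measure mu mw w0.
move=> A mA; rewrite -nuE; move: A mA.
apply: (@eq_measure_cyl R p I (distribution mu S) nu J) => /=.
  by rewrite /distribution/= /pushforward preimage_setT probability_setT ltry.
move=> s x us Js; rewrite nuE /distribution /pushforward.
have -> : S @^-1` cyl s x = cyl s (S' x).
  apply/seteqP; split=> [y /= h i si|y h i si].
    have [iJ|iJ] := boolP (i \in J); last by rewrite S'out// -(Sout y)// h.
    by rewrite -{1}(SK y); apply: S'loc => // j /Js; exact: h.
  have [iJ|iJ] := boolP (i \in J); last by rewrite /= Sout// h// S'out.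
  by rewrite -[in RHS](S'K x); apply: Sloc => // j /Js; exact: h.
rewrite (eq_integral (cst (weight J (S' x) / weight J x)%:E)); last first.
  move=> y; rewrite inE => h; congr (_ / _)%:E.
    apply: eq_big_seq => i iJ; congr (a i _); apply: S'loc => // j /Js.
    exact: h.
  by apply: eq_big_seq => i iJ; rewrite h//; exact: Js.
rewrite integral_cst; last exact: measurable_cyl.
have splitE z : \prod_(i <- s) a i (z i) =
    weight J z * \prod_(i <- s | i \notin J) a i (z i).
  rewrite (bigID (mem J))/=; congr (_ * _).
  rewrite -big_filter; apply: perm_big; apply: uniq_perm => //.
    exact: filter_uniq.
  by move=> i; rewrite mem_filter; apply: andb_idr; exact: Js.
transitivity (\prod_(i <- s) a i (S' x i))%:E; first exact: muE.
transitivity ((weight J (S' x) / weight J x)%:E * (\prod_(i <- s) a i (x i))%:E)%E;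
  last by congr (_ * _)%E; apply/esym; exact: muE.
rewrite -EFinM !splitE mulrA divfK; last by rewrite gt_eqF// weight_gt0.
by congr (_ * _)%:E; apply: eq_bigr => i iJ; rewrite S'out.
Qed.

End local_transformations.

(** * Averages of isometries *)

Section averaging.
Context d (T : measurableType d) (R : realType).
Variable mu : {measure set T -> \bar R}.
Local Notation energy := (energy mu).
Local Notation op := ((T -> R[i]) -> T -> R[i]).

Definition isometric_op (U : op) := forall f, cmeasurable f ->
  cmeasurable (U f) /\ energy (U f) = energy f.

Definition average (I : finType) (U : I -> op) : op :=
  fun f x => #|I|%:R^-1 * \sum_i U i f x.

Lemma linear_op_average (I : finType) (U : I -> op) :
  (forall i, linear_op (U i)) -> linear_op (average U).
Proof.
move=> lU c f g; apply/funext => x; rewrite /average.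
under eq_bigr do rewrite lU.
by rewrite big_split/= -mulr_sumr mulrDr mulrCA.
Qed.

Lemma cmeasurable_average (I : finType) (U : I -> op) f :
  (forall i, isometric_op (U i)) -> cmeasurable f -> cmeasurable (average U f).
Proof.
move=> iU mf; apply: cmeasurableM; first exact: cmeasurable_cst.
by apply: cmeasurable_sum => i; have [] := iU i f mf.
Qed.

(** Invariance of the average under every U i takes the place of self-adjointness of a
    projection. *)
Lemma average_pythagoras (I : finType) (U : I -> op) f : (0 < #|I|)%N ->
  (forall i, linear_op (U i)) -> (forall i, isometric_op (U i)) ->
  (forall i, U i (average U f) = average U f) -> cmeasurable f ->
  (energy (fun x => f x - average U f x)%R + energy (average U f) = energy f)%E.
Proof.
move=> I0 lU iU Uav mf; have mav := cmeasurable_average iU mf.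
set g := average U f in Uav mav *.
have n0 : #|I|%:R != 0 :> R by rewrite pnatr_eq0 -lt0n.
(* After multiplication by the size of [I], the energies of f and f - g become sums of equal terms,
   and a different isometry can be applied in each term. *)
suff : (#|I|%:R%:E * (energy (fun x => f x - g x)%R + energy g) =
    #|I|%:R%:E * energy f)%E.
  move/(congr1 (fun e => (#|I|%:R^-1)%:E * e)%E).
  by rewrite !muleA -EFinM mulVf// !mul1e.
have sumE (e : \bar R) : (0 <= e)%E -> (#|I|%:R%:E * e = \sum_(i : I) e)%E.
  case: e => [e|_|//]; last first.
    rewrite gt0_muley ?lte_fin ?ltr0n// sumr_const -[in RHS](prednK I0).
    elim: #|I|.-1 => [//|j IH]; by rewrite mulrS -IH.
  by move=> e0; rewrite sumEFin sumr_const -EFinM mulr_natl.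
rewrite muleDr ?energy_ge0//; last first.
  by rewrite ge0_adde_def// inE energy_ge0.
rewrite (sumE _ (energy_ge0 mu f)).
rewrite (sumE _ (energy_ge0 mu (fun x => f x - g x))).
(* Each U i fixes the average g, so |f - g| and |U i f - g| have equal energy, and
   the pointwise identity sum_nsqB_mean can be integrated. *)
under eq_bigr => i _.
  have [_ <-] := iU i _ (cmeasurableB mf mav).
  rewrite linear_opB// Uav.
  over.
under [RHS]eq_bigr => i _ do (have [_ <-] := iU i f mf).
have mU i : cmeasurable (U i f) by have [] := iU i f mf.
rewrite -!ge0_integral_sum//; last 4 first.
- by move=> i; exact: measurable_nsq.
- by move=> i x _; rewrite lee_fin nsq_ge0.
- by move=> i; apply: measurable_nsq; exact: cmeasurableB.
- by move=> i x _; rewrite lee_fin nsq_ge0.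
rewrite -ge0_integralZl//; last 2 first.
- exact: measurable_nsq.
- by move=> x _; rewrite lee_fin nsq_ge0.
rewrite -ge0_integralD//.
- apply: eq_integral => x _.
  by rewrite !sumEFin -EFinM -EFinD; congr EFin; exact: sum_nsqB_mean.
- by move=> x _; rewrite sumEFin lee_fin sumr_ge0// => i _; exact: nsq_ge0.
- apply: emeasurable_sum => i.
  exact: (measurable_nsq (cmeasurableB (mU i) mav)).
- by move=> x _; rewrite -EFinM lee_fin mulr_ge0// nsq_ge0.
- by apply: emeasurable_funM => //; exact: measurable_nsq.
Qed.

End averaging.

(** * Weighted composition operators of local bijections *)

Section transport.
Context (R : realType) (p : nat) (I : eqType).
Local Notation X := (conf p I).
Variables (a : I -> 'F_p -> R) (mu : probability X R).
Hypothesis a_gt0 : forall i r, 0 < a i r.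
Hypothesis muE : is_product_measure a mu.
Local Notation weight := (weight a).

(* If S' is the inverse of S, the radicand is the density of the image of mu
   under S' with respect to mu, see local_density. *)
Definition transport (J : seq I) (S : X -> X) (f : X -> R[i]) : X -> R[i] :=
  fun x => (Num.sqrt (weight J (S x) / weight J x))%:C * f (S x).

Lemma linear_op_transport J S : linear_op (transport J S).
Proof. by move=> c f g; apply/funext => x; rewrite /transport; ring. Qed.

Lemma measurable_weight_ratio J (S : X -> X) : measurable_fun setT S ->
  measurable_fun setT (fun x => weight J (S x) / weight J x).
Proof.
move=> mS; apply: measurable_funM; last exact: measurable_weightV.
by apply: measurableT_comp => //; exact: measurable_weight.
Qed.

(** The squared radical is the density of the image of mu under S', so integrating it against |f(S
    x)|^2 amounts to substituting S' x for x, which undoes S. *)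
Lemma isometric_transport J (S S' : X -> X) : uniq J ->
  measurable_fun setT S -> measurable_fun setT S' -> local_inverse J S' S ->
  isometric_op mu (transport J S).
Proof.
move=> uJ mS mS' loc f mf; split.
  apply: cmeasurableM; last exact: cmeasurable_comp.
  apply: cmeasurable_real; apply: (measurableT_comp (f := @Num.sqrt R)).
    by apply: continuous_measurable_fun; exact: sqrt_continuous.
  exact: measurable_weight_ratio.
pose m' := isMeasurableFun.Build _ _ X X S' mS'.
pose S'm : {mfun X >-> X} := HB.pack S' m'.
have w0 x : 0 <= weight J (S x) / weight J x.
  by rewrite divr_ge0// ltW// weight_gt0.
have [S'K _ _ _ _] := loc.
rewrite /energy.
under eq_integral => x _.
  rewrite /transport nsqM nsq_real sqr_sqrtr// mulrC EFinM; over.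
rewrite (@integral_density _ _ _ mu S'm (fun x => weight J (S x) / weight J x)
  _ w0 _ (fun x => (nsq (f (S x)))%:E))//.
- by apply: eq_integral => x _; rewrite /= S'K.
- exact: measurable_weight_ratio.
- exact: (@local_density _ _ _ a mu a_gt0 muE J S'm S uJ mS loc).
- exact/measurable_nsq/cmeasurable_comp.
- by move=> x; rewrite lee_fin nsq_ge0.
Qed.

(** The cocycle identity: the weight of the intermediate point S1 x cancels. This requires the same
    [J] in both factors. *)
Lemma transport_comp J S1 S2 f :
  transport J S1 (transport J S2 f) = transport J (S2 \o S1) f.
Proof.
apply/funext => x; rewrite /transport mulrA; congr (_ * _).
rewrite -rmorphM/= -sqrtrM; last by rewrite divr_ge0// ltW// weight_gt0.
by rewrite mulrC mulrA divfK// gt_eqF// weight_gt0.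
Qed.

Lemma transport_id J f : transport J id f = f.
Proof.
apply/funext => x; rewrite /transport divff; last by rewrite gt_eqF// weight_gt0.
by rewrite sqrtr1 mul1r.
Qed.

Lemma weight_ratio_widen J J' S x : uniq J -> uniq J' -> {subset J <= J'} ->
  (forall i, i \notin J -> S x i = x i) ->
  weight J (S x) / weight J x = weight J' (S x) / weight J' x.
Proof.
move=> uJ uJ' JJ' Sout.
have splitE z : weight J' z =
    weight J z * \prod_(i <- J' | i \notin J) a i (z i).
  rewrite [LHS](bigID (mem J))/=; congr (_ * _).
  rewrite -big_filter; apply: perm_big; apply: uniq_perm => //.
    exact: filter_uniq.
  by move=> i; rewrite mem_filter; apply: andb_idr; exact: JJ'.
rewrite !splitE invfM mulrACA.
rewrite (_ : \prod_(i <- J' | _) a i (S x i) = \prod_(i <- J' | i \notin J) a i (x i)).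
  rewrite divff ?mulr1// gt_eqF//; apply: prodr_gt0 => i _; exact: a_gt0.
by apply: eq_bigr => i iJ; rewrite Sout.
Qed.

Lemma transport_widen J J' S : uniq J -> uniq J' -> {subset J <= J'} ->
  (forall x i, i \notin J -> S x i = x i) -> transport J S = transport J' S.
Proof.
move=> uJ uJ' JJ' Sout; apply/funext => f; apply/funext => x.
by rewrite /transport (weight_ratio_widen uJ uJ' JJ' (Sout x)).
Qed.

End transport.

(** * Row translations and right multiplication *)

Section columns.
Context (p m : nat).
Local Notation X := (conf p (tri_idx m)).

(** All m rows are included because right multiplication moves every row; [pmap insub] discards the
    pairs on or below the diagonal. *)
Definition columns_below N : seq (tri_idx m) :=
  pmap insub [seq (k, n) | k <- enum 'I_m, n <- iota 0 N].

Lemma mem_columns_below N i : (i \in columns_below N) = ((val i).2 < N)%N.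
Proof.
rewrite mem_pmap_sub/=; apply/allpairsP/idP => [[[k n] [_ + ->]]|iN].
  by rewrite mem_iota.
exists ((val i).1, (val i).2); rewrite mem_enum mem_iota/= iN.
by split=> //; exact: surjective_pairing.
Qed.

Lemma uniq_columns_below N : uniq (columns_below N).
Proof.
apply: pmap_sub_uniq; apply: allpairs_uniq; [exact: enum_uniq|exact: iota_uniq|].
by move=> [? ?] [? ?] _ _ [-> ->].
Qed.

Definition row_shift (k : 'I_m) (v : nat -> 'F_p) (x : X) : X :=
  fun i => if (val i).1 == k then x i - v (val i).2 else x i.

Lemma row_shiftD k v w x : row_shift k v (row_shift k w x) =
  row_shift k (fun n => v n + w n) x.
Proof.
apply/funext => i; rewrite /row_shift; case: eqP => // _.
ring.
Qed.

Lemma row_shift0 k x : row_shift k (fun=> 0) x = x.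
Proof. by apply/funext => i; rewrite /row_shift subr0 if_same. Qed.

Lemma measurable_row_shift k v : measurable_fun setT (row_shift k v).
Proof.
apply: measurable_conf_fun => i r; rewrite /row_shift.
have [ik|ik] := eqVneq (val i).1 k; last exact: measurable_coord.
rewrite (_ : mkset _ = [set x : X | x i = r + v (val i).2]).
  exact: measurable_coord.
by apply/seteqP; split=> x /= => [<-|->]; rewrite ?subrK ?addrK.
Qed.

Lemma local_inverse_row_shift k v N : (forall n, (N <= n)%N -> v n = 0) ->
  local_inverse (columns_below N) (row_shift k (fun n => - v n)) (row_shift k v).
Proof.
move=> vN; split=> [x|x|x i|x y xy i iN|x y xy i iN].
- by rewrite row_shiftD -[RHS](row_shift0 k); congr row_shift;
    apply/funext => n; rewrite subrr.
- by rewrite row_shiftD -[RHS](row_shift0 k); congr row_shift;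
    apply/funext => n; rewrite addNr.
- rewrite mem_columns_below -leqNgt => Ni.
  by rewrite /row_shift vN// subr0 if_same.
- by rewrite /row_shift xy.
- by rewrite /row_shift xy.
Qed.

(** A shift does not touch the fixed entries on and below the diagonal, so v has to vanish there. *)
Lemma entry_row_shift (k l : 'I_m) v (x : X) n : (forall j, (j <= k)%N -> v j = 0) ->
  entry (row_shift k v x) l n =
  if l == k then entry x l n - v n else entry x l n.
Proof.
move=> vk; rewrite /entry; case: insubP => [i _ vi|/=].
  by rewrite /row_shift vi.
rewrite -leqNgt => nl; have [lk|//] := eqVneq l k.
have -> : v n = 0 by apply: vk; rewrite -lk.
by rewrite subr0. 
Qed.

Lemma shiftE (k : 'I_m) n (x : X) :
  Defs.shift k n x = row_shift k (fun j => (j == n)%:R) x.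
Proof.
apply/funext => i; rewrite /Defs.shift /row_shift -pair_eqE /pair_eq/=.
by case: eqP => //= _; case: eqP => //= _; rewrite subr0.
Qed.

Definition row_act (t : B0N p) (v : nat -> 'F_p) (n : nat) : 'F_p :=
  \sum_(l < n.+1) v l * t l n.

Lemma row_actK t v : row_act t^-1%g (row_act t v) = v.
Proof.
apply/funext => n; rewrite /row_act (B0N_mulKA v).
by rewrite -[RHS](B0N_sum_one v n); apply: eq_bigr => l _; rewrite B0N_mulrV.
Qed.

(** [Rt t^-1] sends x to x t, and row by row (x - v) t = x t - v t. *)
Lemma Rt_row_shift t (k : 'I_m) v x : (forall n, (n <= k)%N -> v n = 0) ->
  Rt t^-1%g (row_shift k v x) = row_shift k (row_act t v) (Rt t^-1%g x).
Proof.
move=> vk; apply/funext => i; rewrite /Rt /row_shift invgK.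
under eq_bigr do rewrite entry_row_shift//.
case: eqP => // _; rewrite /row_act -sumrB.
by apply: eq_bigr => l _; rewrite mulrBl.
Qed.

(** Since t is upper triangular, column n of x t uses only the columns of x up to n; since t is the
    identity from column N on, later columns are left alone. *)
Lemma local_inverse_Rt (t : B0N p) N :
  (forall i j, (N <= j)%N -> t i j = (i == j)%:R) ->
  (forall i j, (N <= j)%N -> t^-1%g i j = (i == j)%:R) ->
  local_inverse (columns_below N) (@Rt p m t) (Rt t^-1%g).
Proof.
have loc s : forall x y : X, {in columns_below N, x =1 y} ->
    {in columns_below N, Rt s x =1 Rt s y}.
  move=> x y xy i; rewrite mem_columns_below => iN.
  apply: eq_bigr => l _; congr (_ * _); rewrite /entry; case: insubP => [j _ vj|//].
  by rewrite xy// mem_columns_below vj (leq_trans (ltn_ord l)).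
move=> tN sN; split=> [x|x|x i|x y|x y]; [| | |exact: loc|exact: loc].
- by rewrite -RtM mulVg Rt1.
- by rewrite -RtM mulgV Rt1.
rewrite mem_columns_below -leqNgt => Ni; rewrite /Rt invgK.
rewrite big_ord_recr/= tN// eqxx mulr1 big1 ?add0r ?entry_tri// => l _.
by rewrite tN// ltn_eqF// mulr0.
Qed.

End columns.

(** * Finite vectors as parameters of translations *)

Section extension.
Context (p N : nat).

(** Entries of v below b are ignored, so each translation is indexed several times, equally often.
    An average does not notice this, and the index type stays the same while b varies. *)
Definition ext (b : nat) (v : {ffun 'I_N -> 'F_p}) (n : nat) : 'F_p :=
  if (b <= n)%N then oapp v 0 (insub n) else 0.

Lemma ext_lt b v n : (n < b)%N -> ext b v n = 0.
Proof. by rewrite /ext ltnNge; case: leqP. Qed.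

Lemma ext_ge b v n : (N <= n)%N -> ext b v n = 0.
Proof. by move=> Nn; rewrite /ext insubF ?if_same// ltnNge Nn. Qed.

Lemma ext_ord b v (i : 'I_N) : (b <= i)%N -> ext b v i = v i.
Proof. by move=> bi; rewrite /ext bi valK. Qed.

Lemma extD b v w n : ext b (v + w) n = ext b v n + ext b w n.
Proof.
rewrite /ext; case: ifP => _; last by rewrite addr0.
by case: insubP => [i _ _|_]; rewrite /= ?ffunE ?addr0.
Qed.

Lemma ext_split b v (i : 'I_N) : i = b :> nat ->
  ext b v = (fun n => (if n == b then v i else 0) + ext b.+1 v n).
Proof.
move=> ib; apply/funext => n; rewrite /ext; case: (ltngtP b n) => [bn|bn|bn].
- by rewrite add0r.
- by rewrite addr0.
- by rewrite addr0 -bn -ib valK.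
Qed.

Lemma ext_surj b (u : nat -> 'F_p) : (forall n, (n < b)%N -> u n = 0) ->
  (forall n, (N <= n)%N -> u n = 0) ->
  u = ext b [ffun i : 'I_N => u i].
Proof.
move=> ub uN; apply/funext => n; rewrite /ext; case: leqP => [bn|/ub//].
by case: insubP => [i _ <-|]; rewrite /= ?ffunE// -leqNgt => /uN.
Qed.

End extension.

(** * The Laplace operators *)

(** On the left the entry v i is ignored and c stands in its place, so each vector [ext b v] is
    counted once for every value of v i. *)
Lemma sum_ext_split (V : nmodType) (p N b : nat) (i : 'I_N)
    (G : (nat -> 'F_p) -> V) : i = b :> nat ->
  \sum_c \sum_(v : {ffun 'I_N -> 'F_p})
    G (fun n => (if n == b then c else 0) + ext b.+1 v n) =
  (\sum_(v : {ffun 'I_N -> 'F_p}) G (ext b v)) *+ #|'F_p|.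
Proof.
move=> ib; pose e c : {ffun 'I_N -> 'F_p} := [ffun j => if j == i then c else 0].
rewrite exchange_big/=.
(* Translating c by v i here, and v by [e c] on the other side, puts the value v i + c in column b
   on both sides. *)
under eq_bigr => v _ do
  rewrite (reindex_inj (addrI (v i : 'F_p)))/=.
rewrite exchange_big/= -sumr_const; apply: eq_bigr => c _.
rewrite [RHS](reindex_inj (addIr (e c)))/=; apply: eq_bigr => v _.
congr G; rewrite (ext_split _ ib) !ffunE eqxx; apply/funext => n; congr (_ + _).
rewrite extD; case: (ltnP b n) => [bn|nb]; last by rewrite !ext_lt ?addr0.
rewrite /ext bn; case: insubP => [j _ jn|_]; rewrite /= ?ffunE ?addr0//.
by rewrite -val_eqE/= jn ib gtn_eqF// addr0.
Qed.

Section laplace_operators.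
Context (R : realType) (p m : nat).
Hypothesis p_prime : prime p.
Implicit Types k : 'I_m.
Local Notation X := (conf p (tri_idx m)).
Variables (alpha : 'I_m -> nat -> 'F_p -> R) (mu : probability X R).
Hypothesis alpha_gt0 : forall (k : 'I_m) n r, (k < n)%N -> 0 < alpha k n r.

Definition tri_weight (i : tri_idx m) : 'F_p -> R := alpha (val i).1 (val i).2.

Hypothesis muE : is_product_measure tri_weight mu.

Local Notation U N := (transport tri_weight (columns_below m N)).

Lemma tri_weight_gt0 i r : 0 < tri_weight i r.
Proof. by apply: alpha_gt0; exact: (valP i). Qed.

Let card_Fp_gt0 : (0 < #|'F_p|)%N.
Proof. by rewrite card_Fp// prime_gt0. Qed.

Lemma shiftT_transport k n N : (k < n)%N -> (n < N)%N ->
  shiftT alpha k n = U N (Defs.shift k n).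
Proof.
move=> kn nN; apply/funext => f; apply/funext => x.
pose i0 : tri_idx m := exist _ (k, n) kn.
rewrite /transport -(@weight_ratio_widen _ _ _ tri_weight tri_weight_gt0 [:: i0])//.
- rewrite /weight !big_seq1 /shiftT /tri_weight/= -(entry_tri x i0)/=.
  by rewrite /Defs.shift/= eqxx -(entry_tri x i0).
- exact: uniq_columns_below.
- by move=> i; rewrite inE => /eqP ->; rewrite mem_columns_below.
move=> i; rewrite inE /Defs.shift => ii0; case: eqP => // ikn.
by case/eqP: ii0; exact: val_inj.
Qed.

Lemma iter_shiftT k n N j : (k < n)%N -> (n < N)%N ->
  iter j (shiftT alpha k n) =1
  U N (row_shift k (fun l => if l == n then j%:R else 0)).
Proof.
move=> kn nN; elim: j => [|j IH] f /=.
  rewrite (_ : row_shift _ _ = id) ?(transport_id tri_weight_gt0)//.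
  apply/funext => x; rewrite -[RHS](row_shift0 k); congr row_shift.
  by apply/funext => l; rewrite if_same.
rewrite IH (shiftT_transport kn nN) (transport_comp tri_weight_gt0).
congr transport; apply/funext => x /=; rewrite shiftE row_shiftD.
congr row_shift; apply/funext => l.
by case: eqP => _; rewrite ?addr0// -natr1.
Qed.

Lemma avgC_shiftT k n N f x : (k < n)%N -> (n < N)%N ->
  avgC (shiftT alpha k n) f x =
  \sum_c U N (row_shift k (fun l => if l == n then c else 0)) f x.
Proof.
move=> kn nN; apply: eq_bigr => c _.
by rewrite (iter_shiftT _ kn nN) natr_Zp.
Qed.

Definition row_average k N : (X -> R[i]) -> X -> R[i] :=
  average (fun v : {ffun 'I_N -> 'F_p} => U N (row_shift k (ext k.+1 v))).

(** Independent averages over single columns combine into one average over all of them. The last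
    column is r, hence the bound r.+1. *)
Lemma laplace_seqE k r : laplace_seq alpha k r = row_average k r.+1.
Proof.
set N := r.+1.
have cardV : #|{ffun 'I_N -> 'F_p}|%:R != 0 :> R[i].
  by rewrite pnatr_eq0 -lt0n card_ffun expn_gt0 card_Fp_gt0.
(* The induction peels off the smallest column, so the lower end b is generalized; q bounds the
   number of remaining factors. *)
suff H : forall q b, (k < b)%N -> (b + q >= N)%N ->
    \big[comp/id]_(b <= n < N)
      (fun f x => p%:R^-1 * avgC (shiftT alpha k n) f x) =
    average (fun v : {ffun 'I_N -> 'F_p} => U N (row_shift k (ext b v))).
  exact: (H N k.+1 (ltnSn k) (leq_addl _ _)).
elim=> [|q IH] b kb.
  (* From b >= N on, [ext b v] is zero and the average consists of identities. *)
  rewrite addn0 => Nb; rewrite big_geq//; apply/funext => f; apply/funext => x.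
  rewrite /average (eq_bigr (fun=> f x)); last first.
    move=> v _; rewrite (_ : row_shift _ _ = id) ?(transport_id tri_weight_gt0)//.
    apply/funext => y; rewrite -[RHS](row_shift0 k); congr row_shift.
    apply/funext => n; have [/ext_lt->//|bn] := ltnP n b.
    by rewrite ext_ge// (leq_trans Nb).
  by rewrite sumr_const -[X in _ * X]mulr_natl mulKf.
move=> Nbq; have [Nb|bN] := leqP N b.
  by apply: IH; rewrite // (leq_trans Nb)// leq_addr.
rewrite big_ltn// IH; [|exact: leqW|by rewrite addSnnS].
apply/funext => f; apply/funext => x; rewrite /= (avgC_shiftT _ _ kb bN).
under eq_bigr => c _.
  have lS := linear_op_transport tri_weight (columns_below m N)
    (row_shift k (fun l => if l == b then c else 0)).
  rewrite /average (linear_opZ _ _ lS) (linear_op_sum _ _ lS).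
  over.
rewrite -mulr_sumr.
under eq_bigr => c _ do under eq_bigr => v _ do
  rewrite (transport_comp tri_weight_gt0).
transitivity (p%:R^-1 * (#|{ffun 'I_N -> 'F_p}|%:R^-1 *
   \sum_c \sum_(v : {ffun 'I_N -> 'F_p}) U N (row_shift k
      (fun n => (if n == b then c else 0) + ext b.+1 v n)) f x)).
  congr (_ * (_ * _)); apply: eq_bigr => c _; apply: eq_bigr => v _.
  congr (transport _ _ _ f x); apply/funext => y /=; rewrite row_shiftD.
  by congr row_shift; apply/funext => n; rewrite addrC.
rewrite (sum_ext_split (i := Ordinal bN) (fun u => U N (row_shift k u) f x))//.
rewrite card_Fp// -[X in _ * (_ * X)]mulr_natl [X in _ * X]mulrCA mulKf//.
by rewrite pnatr_eq0 -lt0n prime_gt0.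
Qed.

Lemma isometric_row_shift k N (v : {ffun 'I_N -> 'F_p}) b :
  isometric_op mu (U N (row_shift k (ext b v))).
Proof.
apply: (isometric_transport tri_weight_gt0 muE (uniq_columns_below m N)).
- exact: measurable_row_shift.
- exact: (measurable_row_shift k (fun n => - ext b v n)).
- by apply: local_inverse_row_shift => n; exact: ext_ge.
Qed.

(** Adding the vector of u permutes the index group, so the average absorbs the translation from
    either side. *)
Lemma row_shift_average k N (u : nat -> 'F_p) f :
  (forall n, (n < k.+1)%N -> u n = 0) -> (forall n, (N <= n)%N -> u n = 0) ->
  U N (row_shift k u) (row_average k N f) = row_average k N f /\
  row_average k N (U N (row_shift k u) f) = row_average k N f.
Proof.
move=> uk uN; rewrite (@ext_surj p N k.+1 u uk uN); set w := finfun _.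
split; apply/funext => x; rewrite /row_average /average.
  rewrite {1}/transport mulrCA mulr_sumr; congr (_ * _).
  rewrite [RHS](reindex_inj (addIr w))/=; apply: eq_bigr => v _.
  rewrite -[LHS]/(U N (row_shift k (ext k.+1 w)) (U N (row_shift k (ext k.+1 v)) f) x).
  rewrite (transport_comp tri_weight_gt0).
  congr (transport _ _ _ f x); apply/funext => y /=; rewrite row_shiftD.
  by congr row_shift; apply/funext => n; rewrite extD.
congr (_ * _); rewrite [RHS](reindex_inj (addIr w))/=; apply: eq_bigr => v _.
rewrite (transport_comp tri_weight_gt0).
congr (transport _ _ _ f x); apply/funext => y /=; rewrite row_shiftD.
by congr row_shift; apply/funext => n; rewrite extD addrC.
Qed.

Let cardV (N : nat) : #|{ffun 'I_N -> 'F_p}|%:R != 0 :> R[i].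
Proof. by rewrite pnatr_eq0 -lt0n card_ffun expn_gt0 card_Fp_gt0. Qed.

Lemma linear_op_row_average k N : linear_op (row_average k N).
Proof. by apply: linear_op_average => v; exact: linear_op_transport. Qed.

Lemma cmeasurable_row_average k N f :
  cmeasurable f -> cmeasurable (row_average k N f).
Proof. by apply: cmeasurable_average => v; exact: isometric_row_shift. Qed.

Lemma row_average_pythagoras k N f : cmeasurable f ->
  (energy mu (fun x => f x - row_average k N f x)%R +
   energy mu (row_average k N f) = energy mu f)%E.
Proof.
apply: average_pythagoras.
- by rewrite card_ffun expn_gt0 card_Fp_gt0.
- by move=> v; exact: linear_op_transport.
- by move=> v; exact: isometric_row_shift.
by move=> v; have [] := @row_shift_average k N (ext k.+1 v) f
  (fun n (nk : (n < k.+1)%N) => ext_lt v nk) (ext_ge _ v).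
Qed.

(** Every translation in the smaller average belongs to the larger group and is absorbed. Pythagoras
    at level N, applied to the average at level M, then compares the two levels. *)
Lemma row_average_comp k M N f : (M <= N)%N ->
  row_average k N (row_average k M f) = row_average k N f.
Proof.
move=> MN; have lN := linear_op_row_average k N.
rewrite {2}/row_average /average linear_opZ// linear_op_sum//.
apply/funext => x; rewrite (eq_bigr (fun=> row_average k N f x)); last first.
  move=> v _; rewrite (transport_widen tri_weight_gt0 (J' := columns_below m N)).
  - by have [_ ->] := @row_shift_average k N (ext k.+1 v) f
      (fun n (nk : (n < k.+1)%N) => ext_lt v nk) (fun n Nn => ext_ge _ v (leq_trans MN Nn)).
  - exact: uniq_columns_below.
  - exact: uniq_columns_below.
  - by move=> i; rewrite !mem_columns_below => /leq_trans; apply.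
  - have [_ _ + _ _] := @local_inverse_row_shift p m k (ext k.+1 v) M (ext_ge _ _).
    by apply.
by rewrite sumr_const -[X in _ * X]mulr_natl mulKf.
Qed.

Lemma contraction_row_average k N : energy_contraction mu (row_average k N).
Proof.
move=> f mf; split; first exact: cmeasurable_row_average.
by rewrite -[leRHS](row_average_pythagoras k N mf); apply: leeDr; exact: energy_ge0.
Qed.

Lemma slim_exists_laplace k : slim_exists mu (laplace_seq alpha k).
Proof.
apply: slim_exists_projections => [r|r|r s f rs mf]; rewrite !laplace_seqE.
- exact: linear_op_row_average.
- exact: contraction_row_average.
rewrite -(row_average_comp k f (_ : r.+1 <= s.+1)%N)//.
by apply: row_average_pythagoras; exact: cmeasurable_row_average.
Qed.

(** Moving the translation by v past right multiplication turns it into the translation by v t.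
    Since t is the identity from column N on, v t still vanishes there, so v |-> v t permutes the
    translations averaged at level N. *)
Lemma row_average_Rt k (t : B0N p) N :
  (forall i j, (N <= j)%N -> t i j = (i == j)%:R) ->
  forall f, row_average k N (U N (Rt t^-1%g) f) =
            U N (Rt t^-1%g) (row_average k N f).
Proof.
move=> tN f; have lU := linear_op_transport tri_weight (columns_below m N) (Rt t^-1%g).
rewrite [in RHS]/row_average /average linear_opZ// linear_op_sum//.
rewrite /row_average /average; apply/funext => x; congr (_ * _).
(* On the unused coordinates up to k the reindexing psi is the identity, only to
   make it a bijection. *)
pose psi (v : {ffun 'I_N -> 'F_p}) : {ffun 'I_N -> 'F_p} :=
  [ffun i : 'I_N => if (k < i)%N then row_act t (ext k.+1 v) i else v i].
have ext_psi v : ext k.+1 (psi v) = row_act t (ext k.+1 v).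
  apply/funext => n; have [nk|kn] := leqP n k.
    rewrite ext_lt// /row_act big1// => l _.
    by rewrite ext_lt ?mul0r// ltnS (leq_trans _ nk)// -ltnS.
  have [Nn|nN] := leqP N n.
    rewrite ext_ge// /row_act big_ord_recr/= ext_ge// mul0r addr0 big1// => l _.
    by rewrite tN// ltn_eqF// mulr0.
  by rewrite (@ext_ord p N k.+1 (psi v) (Ordinal nN))// ffunE kn.
have psi_inj : injective psi.
  move=> v w vw; have ext_eq : ext k.+1 v = ext k.+1 w.
    by rewrite -[LHS](row_actK t) -[RHS](row_actK t) -!ext_psi vw.
  apply/ffunP => i; have [ik|ki] := leqP i k.
    by have /ffunP/(_ i) := vw; rewrite !ffunE ltnNge ik.
  by rewrite -(ext_ord v ki) -(ext_ord w ki) ext_eq.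
rewrite [RHS](reindex_inj psi_inj)/=; apply: eq_bigr => v _.
rewrite !(transport_comp tri_weight_gt0); congr (transport _ _ _ f x).
apply/funext => y /=; rewrite ext_psi Rt_row_shift//.
by move=> n nk; rewrite ext_lt.
Qed.

Definition identity_beyond N (t : B0N p) :=
  forall i j, (N <= j)%N -> t i j = (i == j)%:R.

Let identity_beyondP (t : B0N p) :
  exists N, identity_beyond N t /\ identity_beyond N t^-1%g.
Proof.
have [N1 tN1] := B0N_col t; have [N2 tN2] := B0N_col t^-1%g.
by exists (maxn N1 N2); split=> i j; rewrite geq_max => /andP[];
  [move=> /tN1|move=> _ /tN2].
Qed.

Lemma isometric_Rt (t : B0N p) N :
  identity_beyond N t -> identity_beyond N t^-1%g ->
  isometric_op mu (U N (Rt t^-1%g)).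
Proof.
move=> tN sN; apply: (isometric_transport tri_weight_gt0 muE
  (uniq_columns_below m N) (measurable_Rt _) (measurable_Rt t)).
exact: local_inverse_Rt.
Qed.

(** The derivative inside [repT] is identified with the explicit quotient of weights by
    [local_density]; uniqueness of derivatives holds only up to null sets. *)
Lemma repT_transport (t : B0N p) N g :
  identity_beyond N t -> identity_beyond N t^-1%g ->
  repT mu t g = U N (Rt t^-1%g) g %[ae mu].
Proof.
move=> tN sN; have := @Radon_Nikodym_density _ _ _ mu (@Rt p m t)
  (fun x => weight tri_weight (columns_below m N) (Rt t^-1%g x) /
            weight tri_weight (columns_below m N) x) _ _.
move=> /(_ (measurable_weight_ratio _ _ (measurable_Rt _))).
move=> /(_ (local_density tri_weight_gt0 muE (uniq_columns_below m N)
  (measurable_Rt _) (@local_inverse_Rt p m t N tN sN))).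
by apply: filterS => x /= RN I; rewrite /repT RN.
Qed.

Lemma L2_isometric_op (V : (X -> R[i]) -> X -> R[i]) g :
  isometric_op mu V -> L2 mu g -> L2 mu (V g).
Proof.
move=> isoV /L2P[mg Eg]; have [mV EV] := isoV g mg.
by apply/L2P; split=> //; rewrite EV.
Qed.

Lemma L2_repT (t : B0N p) g : L2 mu g -> L2 mu (repT mu t g).
Proof.
move=> L2g; have [N [tN sN]] := identity_beyondP t.
have /L2P[mT ET] := L2_isometric_op (isometric_Rt tN sN) L2g.
have /L2P[mg _] := L2g.
(* Equality almost everywhere does not transfer measurability, which is therefore read off from the
   derivative itself. *)
have mrep : cmeasurable (repT mu t g).
  apply: cmeasurableM; last exact: cmeasurable_comp (measurable_Rt _) mg.
  apply: cmeasurable_real; apply: (measurableT_comp (f := @Num.sqrt R)).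
    by apply: continuous_measurable_fun; exact: sqrt_continuous.
  by apply: measurableT_comp => //; exact: measurable_Radon_Nikodym.
by apply/L2P; split=> //; rewrite (eq_energy mrep mT (@repT_transport t N _ tN sN)).
Qed.

Lemma commutes_with_rep_laplace k : commutes_with_rep mu (laplace alpha mu k).
Proof.
move=> t f L2f; have [N [tN sN]] := identity_beyondP t.
have isoT := isometric_Rt tN sN.
have linT := linear_op_transport tri_weight (columns_below m N) (Rt t^-1%g).
have sA := slimP (slim_exists_laplace k); have [[_ A2 _ _] _] := sA.
have contrT : energy_contraction mu (U N (Rt t^-1%g)).
  by move=> g mg; have [mTg ->] := isoT g mg.
have comm : laplace alpha mu k (U N (Rt t^-1%g) f) =
    U N (Rt t^-1%g) (laplace alpha mu k f) %[ae mu].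
  apply: (slim_commute _ sA linT contrT) => //.
    by move=> n g mg; rewrite laplace_seqE; exact: cmeasurable_row_average.
  exists N => n g Nn; rewrite laplace_seqE.
  (* The coordinate set is enlarged to the one used by the average, so that the two compose
     exactly. *)
  have -> : U N (Rt t^-1%g) = U n.+1 (Rt t^-1%g).
    apply: (transport_widen tri_weight_gt0) => //; try exact: uniq_columns_below.
      by move=> i; rewrite !mem_columns_below => /leq_trans; apply; exact: leqW.
    by have [_ _ + _ _] := @local_inverse_Rt p m t N tN sN.
  by apply: row_average_Rt => i j nj; apply: tN; rewrite (leq_trans _ nj)// leqW.
(* Inside the limit operator, [repT] may be exchanged for the transport because a bounded operator
   respects equality almost everywhere. *)
have := A2 _ _ (L2_repT t L2f) (L2_isometric_op isoT L2f)
  (@repT_transport t N f tN sN).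
have := @repT_transport t N (laplace alpha mu k f) tN sN.
move: comm; apply: filterS3 => x /= e1 e2 e3 I.
exact: etrans (e3 I) (etrans (e1 I) (esym (e2 I))).
Qed.

Lemma laplace_prod_bounded_commutes :
  bounded_operator mu (laplace_prod alpha mu) /\
  commutes_with_rep mu (laplace_prod alpha mu).
Proof.
rewrite /laplace_prod; apply: (big_rec (fun A => bounded_operator mu A /\
  commutes_with_rep mu A)).
  by split; [exact: bounded_operator_id|move=> t f _; exact: ae_eq_refl].
move=> k B _ [bB cB]; have [bA _] := slimP (slim_exists_laplace k).
split=> [|t f L2f]; first exact: bounded_operator_comp.
have [B1 _ _ _] := bB; have [_ A2 _ _] := bA.
have := A2 _ _ (B1 _ (L2_repT t L2f)) (L2_repT t (B1 _ L2f)) (cB t f L2f).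
have := @commutes_with_rep_laplace k t _ (B1 _ L2f).
by apply: filterS2 => x /= e1 e2 I; exact: etrans (e2 I) (e1 I).
Qed.

End laplace_operators.

Theorem lemma4p6 (R : realType) (p m : nat) (p_prime : prime p)
    (m_gt0 : (0 < m)%N)
    (alpha : 'I_m -> nat -> 'F_p -> R)
    (alpha_gt0 : forall (k : 'I_m) n r, (k < n)%N -> 0 < alpha k n r)
    (alpha_sum1 : forall (k : 'I_m) n, (k < n)%N -> \sum_r alpha k n r = 1)
    (mu mu_inv : probability (conf p (tri_idx m)) R)
    (mu_row mu_inv_row : forall k : 'I_m, probability (conf p (row_idx k)) R)
    (muE : is_product_measure
       (fun i : tri_idx m => alpha (val i).1 (val i).2) mu)
    (mu_invE : is_product_measure
       (fun (_ : tri_idx m) (_ : 'F_p) => p%:R^-1) mu_inv)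
    (mu_rowE : forall k : 'I_m, is_product_measure
       (fun n : row_idx k => alpha k (val n)) (mu_row k))
    (mu_inv_rowE : forall k : 'I_m, is_product_measure
       (fun (_ : row_idx k) (_ : 'F_p) => p%:R^-1) (mu_inv_row k)) :
  (forall k : 'I_m, mequiv (mu_row k) (mu_inv_row k) ->
     slim_exists mu (laplace_seq alpha k) /\
     commutes_with_rep mu (laplace alpha mu k)) /\
  (mequiv mu mu_inv ->
     (forall k : 'I_m, slim_exists mu (laplace_seq alpha k)) /\
     bounded_operator mu (laplace_prod alpha mu) /\
     commutes_with_rep mu (laplace_prod alpha mu)).
Proof.
have slimk := slim_exists_laplace p_prime alpha_gt0 muE.
split=> [k _|_].
  by split; [exact: slimk|exact: commutes_with_rep_laplace].
by split; [exact: slimk|exact: laplace_prod_bounded_commutes].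
Qed.
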